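(* Let $n\ge 2$, let $k_1,\dots,k_n$ be nonnegative integers, $\lambda=\sum_{i=1}^nk_i\lambda_i$ and $|\lambda|=\sum_{i=1}^nk_i$. With the polynomial realization $V_n(\lambda)=\overline{M}$ and its grading described in the context, for $0\le r\le|\lambda|$ we have $$\dim(V_n(\lambda))_r=\sum_{s=0}^{n-1}(-1)^s\binom{n+r-1-\sum_{j=1}^s(k_j+1)}{n-1}\,d_{n-1}\Big(\sum_{i=1}^sk_i\lambda_i+\lambda_s+\sum_{i=s}^{n-1}k_{i+1}\lambda_i\Big).$$ Moreover, $$\sum_{s=0}^{n-1}(-1)^s\binom{\sum_{j=s+1}^n(k_j+1)}{n}\,d_{n-1}\Big(\sum_{i=1}^sk_i\lambda_i+\lambda_s+\sum_{i=s}^{n-1}k_{i+1}\lambda_i\Big)=d_n\Big(\sum_{\ell=1}^nk_\ell\lambda_\ell\Big).$$ Here $\lambda_0=0$.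
   Context: Binomial convention: for $p\in\mathbb{Z}$ and $q\in\mathbb{N}=\{0,1,2,\dots\}$, $\binom{p}{q}=\frac{p!}{q!(p-q)!}$ if $p\ge q$ and $\binom{p}{q}=0$ if $p<q$. The base field is $\mathbb{C}$; $E_{i,j}$ denotes the matrix unit with $1$ in position $(i,j)$. For $\mathfrak{sl}(m+1)$ the Cartan subalgebra is spanned by $h_i=E_{m+2-i,m+2-i}-E_{m+1-i,m+1-i}$ ($1\le i\le m$), the positive root vectors are $E_{i,j}$ with $j<i$, and $\lambda_i(h_r)=\delta_{i,r}$ defines the fundamental weights. For a dominant integral weight $\mu=\sum_{i=1}^ml_i\lambda_i$ of $\mathfrak{sl}(m+1)$, $d_m(\mu)$ is the dimension of the irreducible module of highest weight $\mu$, i.e. $d_m(\mu)=\prod_{1\le i<j\le m+1}\frac{\sum_{r=i}^{j-1}l_r+j-i}{j-i}$. Construction. For $1\le m\le n$ let $\mathcal{C}_m=\mathbb{C}[x_{i,j}\mid 1\le j\le i\le m]$ and $c_m=-\frac{1}{m+1}\sum_{i=0}^{m-1}(m-i)k_{n-m+1+i}$. $\mathfrak{sl}(m+1)$ acts on $\mathcal{C}_m$ inductively. For $m=1$: $E_{1,2}=x_{1,1}^2\partial_{x_{1,1}}-k_nx_{1,1}$, $E_{2,1}=-\partial_{x_{1,1}}$, $E_{1,1}-E_{2,2}=2x_{1,1}\partial_{x_{1,1}}-k_n$. For $2\le m\le n$: make $\mathcal{C}_{m-1}$ a $\mathfrak{gl}(m)$-module by letting $\sum_{i=1}^mE_{i,i}$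 act as the scalar $c_m$; view differential operators on $\mathcal{C}_{m-1}$ as operators on $\mathcal{C}_m$; put $\mathcal{D}_m=\sum_{s=1}^mx_{m,s}\partial_{x_{m,s}}$; and for $i\ne j$ in $\{1,\dots,m\}$ let $E_{i,j}|_{\mathcal{C}_m}=x_{m,i}\partial_{x_{m,j}}+E_{i,j}|_{\mathcal{C}_{m-1}}$, $(E_{i,i}-E_{j,j})|_{\mathcal{C}_m}=x_{m,i}\partial_{x_{m,i}}-x_{m,j}\partial_{x_{m,j}}+(E_{i,i}-E_{j,j})|_{\mathcal{C}_{m-1}}$, $E_{i,m+1}|_{\mathcal{C}_m}=x_{m,i}\mathcal{D}_m+c_mx_{m,i}+\sum_{r=1}^mx_{m,r}E_{i,r}|_{\mathcal{C}_{m-1}}$, $E_{m+1,i}|_{\mathcal{C}_m}=-\partial_{x_{m,i}}$, $(E_{m,m}-E_{m+1,m+1})|_{\mathcal{C}_m}=\mathcal{D}_m+x_{m,m}\partial_{x_{m,m}}+c_m+E_{m,m}|_{\mathcal{C}_{m-1}}$. Put $V^{(1)}=\mathrm{Span}\{x_{1,1}^i\mid 0\le i\le k_n\}\subset\mathcal{C}_1$ and $V^{(m)}=U(\mathfrak{sl}(m+1))\,(1\otimes V^{(m-1)})\subset\mathcal{C}_m=\mathbb{C}[x_{m,1},\dots,x_{m,m}]\otimes\mathcal{C}_{m-1}$ for $2\le m\le n$. Then $V_n(\lambda)=\overline{M}=V^{(n)}\subset\mathcal{C}_n$ is the irreducible $\mathfrak{sl}(n+1)$-module with highest weight $\lambda$,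 and $(V_n(\lambda))_r$ is its subspace of elements homogeneous of degree $r$ in $x_{n,1},\dots,x_{n,n}$. *)

(* Defs.v *)
From HB Require Import structures.
From mathcomp Require Import all_boot all_order all_algebra.
From mathcomp Require Import reals complex mpoly.

Set Implicit Arguments.
Unset Strict Implicit.
Unset Printing Implicit Defensive.

Import Order.TTheory GRing.Theory Num.Theory.
Local Open Scope ring_scope.

(* All indices (of variables, matrix units, weights) are 1-based naturals, so
   [k : nat -> nat] stands for k_1, ..., k_n and only these values are used. *)

Section Subspaces.
Variables (F : fieldType) (V : lmodType F).

Inductive span (S : V -> Prop) : V -> Prop :=
| span_zero : span S 0
| span_cons (a : F) (u v : V) : S u -> span S v -> span S (a *: u + v).

(* The ambient polynomial rings are infinite dimensional, so they carry no
   [vectType] structure and [\dim] is not available. *)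
Definition has_dim (W : V -> Prop) (d : nat) : Prop :=
  exists b : 'I_d -> V,
    [/\ forall i, W (b i),
        forall a : 'I_d -> F, \sum_(i < d) a i *: b i = 0 -> forall i, a i = 0
      & forall v, W v -> exists a : 'I_d -> F, v = \sum_(i < d) a i *: b i].

End Subspaces.

(* Number of pairs (i, j) with 1 <= j <= i <= n, i.e. 'C(n.+1, 2) when n >= 1;
   the successor form is needed by [inord]. *)
Definition nvars (n : nat) : nat := 'C(n.+1, 2).-1.+1.

(* Position of x_{i,j}: the pairs are listed row by row. *)
Definition xidx (n i j : nat) : 'I_(nvars n) := inord ('C(i, 2) + j.-1).

Section Realization.
Variables (F : fieldType) (n : nat) (k : nat -> nat).

(* The ring C_n; every C_m with m <= n is identified with the subring of C_n in
   the variables x_{i,j}, i <= m.  Under this identification 1 (x) V^(m-1) is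
   V^(m-1) itself, and a differential operator on C_(m-1) viewed on C_m is given
   by the same expression. *)
Notation P := {mpoly F[nvars n]}.
Notation op := (P -> P).

Definition x (i j : nat) : P := 'X_(xidx n i j).
Definition dx (i j : nat) : op := fun p => mderiv (xidx n i j) p.

Definition c (m : nat) : F :=
  - (m.+1%:R)^-1 * \sum_(0 <= i < m) ((m - i) * k (n - m + 1 + i))%N%:R.

Definition euler (m : nat) : op :=
  fun p => \sum_(1 <= s < m.+1) x m s * dx m s p.

(* The operators by which sl(m+1) acts on C_m: [offd i j] is E_{i,j} for i <> j
   and [ddiff i j] is E_{i,i} - E_{j,j}, with 1 <= i, j <= m+1. *)
Record sl_ops := SlOps {
  offd : nat -> nat -> op;
  ddiff : nat -> nat -> op }.

(* E_{i,j}, 1 <= i, j <= m, for the gl(m)-module obtained from an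
   sl(m)-module by letting E_{1,1} + ... + E_{m,m} act as c_m:
   m E_{i,i} = sum_t E_{t,t} + sum_t (E_{i,i} - E_{t,t}). *)
Definition gl_op (m : nat) (A : sl_ops) (i j : nat) : op := fun p =>
  if i == j then
    m%:R^-1 *: (c m *: p + \sum_(1 <= t < m.+1) ddiff A i t p)
  else offd A i j p.

Definition sl2_ops : sl_ops := SlOps
  (fun i j p =>
     if (i == 1%N) && (j == 2%N) then
       x 1 1 ^+ 2 * dx 1 1 p - (k n)%:R *: (x 1 1 * p)
     else if (i == 2%N) && (j == 1%N) then - dx 1 1 p
     else 0)
  (fun i j p =>
     let h := 2%:R *: (x 1 1 * dx 1 1 p) - (k n)%:R *: p in
     if (i == 1%N) && (j == 2%N) then h
     else if (i == 2%N) && (j == 1%N) then - h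
     else 0).

(* From sl(m) acting on C_(m-1) to sl(m+1) acting on C_m. *)
Definition step_offd (m : nat) (A : sl_ops) (i j : nat) : op := fun p =>
  if j == m.+1 then
    x m i * euler m p + c m *: (x m i * p)
    + \sum_(1 <= r < m.+1) x m r * gl_op m A i r p
  else if i == m.+1 then - dx m j p
  else x m i * dx m j p + offd A i j p.

Definition step_low (m : nat) (A : sl_ops) (i j : nat) : op := fun p =>
  x m i * dx m i p - x m j * dx m j p + ddiff A i j p.

Definition step_last (m : nat) (A : sl_ops) : op := fun p =>
  euler m p + x m m * dx m m p + c m *: p + gl_op m A m m p.

(* E_{i,i} - E_{m+1,m+1} = (E_{i,i} - E_{m,m}) + (E_{m,m} - E_{m+1,m+1}). *)
Definition step_ddiff (m : nat) (A : sl_ops) (i j : nat) : op := fun p =>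
  if (i == m.+1) && (j == m.+1) then 0
  else if j == m.+1 then step_low m A i m p + step_last m A p
  else if i == m.+1 then - (step_low m A j m p + step_last m A p)
  else step_low m A i j p.

(* The value at m = 0 is a dummy. *)
Fixpoint sl_action (m : nat) : sl_ops :=
  match m with
  | 0 => SlOps (fun _ _ _ => 0) (fun _ _ _ => 0)
  | m'.+1 =>
      if m' is 0 then sl2_ops
      else SlOps (step_offd m'.+1 (sl_action m'))
                 (step_ddiff m'.+1 (sl_action m'))
  end.

(* The vectors X_1 (X_2 (... (X_l w))) with w in W and each X_a one of the basis
   elements E_{i,j} (i <> j), E_{i,i} - E_{i+1,i+1} of sl(m+1); they span
   U(sl(m+1)) W. *)
Inductive sl_words (m : nat) (W : P -> Prop) : P -> Prop :=
| sl_words_nil w : W w -> sl_words m W w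
| sl_words_offd i j p :
    (1 <= i <= m.+1)%N -> (1 <= j <= m.+1)%N -> i <> j ->
    sl_words m W p -> sl_words m W (offd (sl_action m) i j p)
| sl_words_ddiff i p :
    (1 <= i <= m)%N ->
    sl_words m W p -> sl_words m W (ddiff (sl_action m) i i.+1 p).

(* V^(m); the value at m = 0 is a dummy. *)
Fixpoint Vmod (m : nat) : P -> Prop :=
  match m with
  | 0 => fun p => p = 0
  | m'.+1 =>
      if m' is 0 then
        span (fun p => exists2 i : nat, (i <= k n)%N & p = x 1 1 ^+ i)
      else span (sl_words m'.+1 (Vmod m'))
  end.

(* Homogeneous of degree r in x_{n,1}, ..., x_{n,n}. *)
Definition homog_last (r : nat) (p : P) : Prop :=
  forall mo : 'X_{1..nvars n}, mo \in msupp p ->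
    (\sum_(1 <= s < n.+1) mo (xidx n n s) = r)%N.

Definition Vgr (r : nat) (p : P) : Prop := Vmod n p /\ homog_last r p.

End Realization.

Definition binz (p : int) (q : nat) : nat :=
  if q%:Z <= p then 'C(`|p|%N, q) else 0%N.

(* d_m(l_1 lambda_1 + ... + l_m lambda_m). *)
Definition dimsl (m : nat) (l : nat -> nat) : rat :=
  \prod_(1 <= i < m.+2) \prod_(i.+1 <= j < m.+2)
    (((\sum_(i <= r < j) l r) + (j - i))%N%:R / (j - i)%N%:R).

(* Coefficients of
   sum_(i=1..s) k_i lambda_i + lambda_s + sum_(i=s..n-1) k_(i+1) lambda_i,
   evaluated at 1 <= i <= n-1 only, so that lambda_0 = 0. *)
Definition wt (k : nat -> nat) (s i : nat) : nat :=
  ((if i <= s then k i else 0) + (i == s) + (if s <= i then k i.+1 else 0))%N.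

(* Main.v *)
Require Import Defs.
From HB Require Import structures.
From mathcomp Require Import all_boot all_order all_algebra fingroup perm.
From mathcomp Require Import reals complex mpoly.
From mathcomp Require Import boolp ring zify.

Set Implicit Arguments.
Unset Strict Implicit.
Unset Printing Implicit Defensive.

Import Order.TTheory GRing.Theory Num.Theory.
Local Open Scope ring_scope.

(* Let L be the space of polynomials on (n+1) x (n+1) matrices that are killed by
   the operators adding a row to a later one and have degree
   lambda_i = k_(i+1) + ... + k_n in row i. Restricting them to unitriangular
   matrices turns the column operators into the given action of sl(n+1), and the
   Fischer inner product makes the operators E_(i,j) and E_(j,i) adjoint. Since L
   has only one highest weight vector, it is generated by it, so V^(n) is the
   restriction of L. Products of minors show that every semistandard tableau of
   shape lambda is the leading monomial of an element of L; conversely, sl(2)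
   theory for two consecutive rows shows that all leading monomials arise so.
   Hence (V^(n))_r has a basis indexed by the Gelfand-Tsetlin patterns with top
   row lambda and prescribed corner. Summing over the rows of the patterns one at
   a time counts them by a determinant, one column of which records the corner,
   the others being binomial coefficients of lambda_i + n - i; its Laplace
   expansion along that column is the first formula. The second one is the same
   expansion of the determinant with binomial coefficients in every column, which
   is of Vandermonde type. *)

(** * Ballot sequences *)

(** The difficulty is that [Vmod] is given level by level through generators in an
    infinite-dimensional ring, with neither a basis nor relations at hand. On matrices it becomes
    the solution space of linear equations, where an upper and a lower bound on the set of leading
    monomials meet. The levels m < n then only serve to show that nothing outside the restriction of
    L is ever produced, and that the constant 1, the image of the highest weight vector up to a
    scalar, lies in V^(n). Matrix indices run backwards, so the variables x_(n,s) come from row 0,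
    whose degree is |lambda|. Degree r in them means exponent |lambda| - r at the entry (0,0), that
    is, |lambda| - r letters 0 in the first row of the tableau: this is the corner of the pattern.
    The weights in both formulas arise because deleting one of the numbers lambda_i + n - i merges
    two consecutive gaps between them. *)

Section BallotSequences.
Variable F : numFieldType.
Lemma natr_ffact (M l : nat) :
  (M ^_ l)%:R = \prod_(i < l) (M%:R - i%:R) :> F.
Proof.
elim: l => [|l IHl]; first by rewrite big_ord0.
rewrite big_ord_recr /= -IHl ffactnSr natrM.
case: (leqP l M) => [lM|Ml]; first by rewrite natrB.
by rewrite ffact_small // !mul0r.
Qed.

(* The left-hand sides are the values at M of a polynomial of degree at most
   a + b, which vanishes at 0, ..., b - 1 and at c + 1, ..., c + 1 + a. *)
Lemma binomial_window (a b c : nat) (Y : nat -> F) :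
  (b <= c)%N -> (forall l, (l < b)%N -> Y l = 0) ->
  (forall M, (c < M <= c.+1 + a)%N ->
     \sum_(l < (a + b).+1) 'C(M, l)%:R * Y l = 0) ->
  Y b = 0.
Proof.
move=> bc Y0 YM.
pose p := \sum_(l < (a + b).+1)
  (Y l / l`!%:R) *: \prod_(i < l) ('X - (i%:R : F)%:P).
have pE M : p.[M%:R] = \sum_(l < (a + b).+1) 'C(M, l)%:R * Y l.
  rewrite horner_sum; apply: eq_bigr => l _.
  rewrite hornerZ horner_prod.
  under eq_bigr do rewrite hornerXsubC.
  rewrite -natr_ffact -bin_ffact natrM mulrCA divfK //.
  by rewrite pnatr_eq0 -lt0n fact_gt0.
have pM M : (M < b)%N || (c < M <= c.+1 + a)%N -> p.[M%:R] = 0.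
  rewrite pE => /orP[Mb|/YM//]; apply: big1 => l _.
  have [lb|bl] := ltnP l b; first by rewrite Y0 ?mulr0.
  by rewrite bin_small ?mul0r // (leq_trans Mb).
have size_p : (size p <= (a + b).+1)%N.
  apply: (leq_trans (size_sum _ _ _)); apply/bigmax_leqP => l _.
  apply: (leq_trans (size_scale_leq _ _)).
  by rewrite size_prod_XsubC /index_enum -enumT size_enum_ord.
have p0 : p = 0.
  apply/eqP/negPn/negP => p_neq0.
  pose rs : seq F := [seq M%:R | M <- iota 0 b ++ iota c.+1 a.+1].
  have := @max_poly_roots _ p rs p_neq0.
  rewrite size_map size_cat !size_iota.
  have -> : all (root p) rs.
    apply/allP => _ /mapP[M MI ->]; apply/eqP/pM.
    by move: MI; rewrite mem_cat !mem_iota; lia.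
  have -> : uniq rs.
    rewrite map_inj_uniq; last by move=> M M' /eqP; rewrite eqr_nat => /eqP.
    rewrite cat_uniq !iota_uniq andbT; apply/hasPn => M.
    by rewrite !mem_iota; lia.
  by move=> /(_ isT isT) /leq_trans /(_ size_p); lia.
have := pE b; rewrite p0 horner0 (bigD1 (inord b)) //= inordK; last lia.
rewrite binn mul1r big1 ?addr0 => [->//|l lb].
have [l_lt|b_le] := ltnP l b; first by rewrite Y0 ?mulr0.
rewrite bin_small ?mul0r // ltn_neqAle b_le andbT eq_sym.
by apply: contra lb => /eqP lb; apply/eqP/val_inj; rewrite /= inordK //; lia.
Qed.

Implicit Types (c M : nat) (l ds : seq nat) (phi : seq nat -> F).

(** [phi] is the coefficient function of a vector in a tensor product of sl(2)-modules. In a basis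
    rescaled by factorials the operator that shifts one index has all its coefficients equal to
    1. *)
Definition raise phi l : F := \sum_(j < size l) phi (incr_nth l j).

Lemma raise_cons phi x l :
  raise phi (x :: l) = phi (x.+1 :: l) + raise (fun l' => phi (x :: l')) l.
Proof. by rewrite /raise big_ord_recl. Qed.

Lemma eq_raise phi psi s :
  (forall l, size l = s -> phi l = psi l) ->
  forall l, size l = s -> raise phi l = raise psi l.
Proof.
move=> e l ls; apply: eq_bigr => j _.
by apply: e; rewrite size_incr_nth ltn_ord.
Qed.

Lemma raise_sum (I : finType) (a : I -> F) (psi : I -> seq nat -> F) l :
  raise (fun l' => \sum_i a i * psi i l') l = \sum_i a i * raise (psi i) l.
Proof.
by rewrite /raise exchange_big; apply: eq_bigr => i _; rewrite mulr_sumr.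
Qed.

Lemma iter_raise_sum M (I : finType) (a : I -> F) (psi : I -> seq nat -> F) l :
  iter M raise (fun l' => \sum_i a i * psi i l') l
  = \sum_i a i * iter M raise (psi i) l.
Proof.
elim: M l => [|M IHM] l //=; rewrite -raise_sum.
exact: (@eq_raise _ _ (size l)).
Qed.

Lemma iter_raise0 M phi s :
  (forall l, size l = s -> phi l = 0) ->
  forall l, size l = s -> iter M raise phi l = 0.
Proof.
move=> e l ls; elim: M l ls => [|M IHM] l ls /=; first exact: e.
by apply: big1 => j _; rewrite IHM // size_incr_nth ltn_ord.
Qed.

Lemma sum_tail0 (f : nat -> F) m p :
  (m <= p)%N -> (forall i, (m < i)%N -> f i = 0) ->
  \sum_(0 <= i < p.+1) f i = \sum_(0 <= i < m.+1) f i.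
Proof.
move=> mp f0; rewrite (big_cat_nat (n := m.+1)) //=.
rewrite [X in _ + X]big1_seq ?addr0 // => i /andP[_].
by rewrite mem_index_iota => /andP[/f0].
Qed.

Lemma pascal_sum M (G : nat -> F) :
  \sum_(i < M.+1) 'C(M, i)%:R * G i.+1 + \sum_(i < M.+1) 'C(M, i)%:R * G i
  = \sum_(i < M.+2) 'C(M.+1, i)%:R * G i.
Proof.
have -> : \sum_(i < M.+1) 'C(M, i)%:R * G i = \sum_(i < M.+2) 'C(M, i)%:R * G i.
  by rewrite [RHS]big_ord_recr /= bin_small // mul0r addr0.
rewrite [X in _ + X]big_ord_recl [RHS]big_ord_recl !bin0 addrCA; congr (_ + _).
by rewrite -big_split; apply: eq_bigr => i _ /=; rewrite binS natrD mulrDl addrC.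
Qed.

(** Raising the head and raising the tail commute, so this is the binomial theorem for their sum. *)
Lemma iter_raise_cons M phi x l :
  iter M raise phi (x :: l)
  = \sum_(i < M.+1)
      'C(M, i)%:R * iter (M - i) raise (fun l' => phi ((x + i)%N :: l')) l.
Proof.
elim: M x l => [|M IHM] x l.
  by rewrite big_ord_recl big_ord0 addr0 /= bin0 mul1r addn0.
rewrite iterS raise_cons IHM.
rewrite (@eq_raise _ _ (size l) (fun l' _ => IHM x l')) // raise_sum.
rewrite -(pascal_sum M (fun i => iter (M.+1 - i) raise (fun l' => phi ((x + i)%N :: l')) l)).
congr (_ + _); apply: eq_bigr => i _; first by rewrite subSS addSnnS.
by rewrite (subSn (ltn_ord i : (i <= M)%N)).
Qed.

(** Iterated Clebsch-Gordan rule: coupling the highest weight [c] with [d] gives weight c + d - 2b,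
    with b at most [c]. *)
Fixpoint ballot c ds l : bool :=
  match ds, l with
  | d :: ds', b :: l' => (b <= c)%N && ballot (c + (d - b) - b) ds' l'
  | [::], [::] => true
  | _, _ => false
  end.

(* A highest weight vector of a tensor product of sl(2)-modules, of highest
   weights ds after one of highest weight c: the index l of its first coefficient
   never drops below weight 0. *)
Lemma ballot_lexmin ds c phi l :
  size l = size ds ->
  (forall l', size l' = size ds -> phi l' != 0 -> all2 leq l' ds) ->
  (forall l', size l' = size ds -> iter c.+1 raise phi l' = 0) ->
  phi l != 0 ->
  (forall l' J, size l' = size ds -> (J < size ds)%N ->
     (forall j, (j < J)%N -> nth 0%N l' j = nth 0%N l j) ->
     (nth 0%N l' J < nth 0%N l J)%N -> phi l' = 0) ->
  ballot c ds l.
Proof.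
elim: ds c phi l => [|d ds IHds] c phi [|b l] //= [sl] supp Ec phil lmin.
pose g i l' := phi (i :: l').
have g_lt i : (i < b)%N -> forall l', size l' = size ds -> g i l' = 0.
  by move=> ib l' sl'; apply: (lmin (i :: l') 0%N); rewrite //= sl'.
have g_gt i : (d < i)%N -> forall l', size l' = size ds -> g i l' = 0.
  move=> di l' sl'; apply/eqP/negPn/negP => /supp /=.
  by rewrite sl' leqNgt di => /(_ erefl).
(* The hypothesis, split along the first index started at 0: one relation between the slices [g i]
   for each power [M] above [c]. *)
have EM M l' : (c < M)%N -> size l' = size ds ->
    \sum_(i < M.+1) 'C(M, i)%:R * iter (M - i) raise (g i) l' = 0.
  move=> cM sl'; rewrite -(iter_raise_cons M phi 0%N).
  rewrite -(subnK cM) iterD; apply: (@iter_raise0 _ _ (size ds).+1) => //=.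
  by rewrite sl'.
have bd : (b <= d)%N.
  by have /(_ (b :: l)) := supp; rewrite /= sl => /(_ erefl phil) /andP[].
(* Otherwise [EM] may be used with [M] equal to [b]; minimality kills the slices below [b], and only
   [phi (b :: l)] remains. *)
have bc : (b <= c)%N.
  rewrite leqNgt; apply/negP => cb; have := EM b l cb sl.
  rewrite big_ord_recr /= binn mul1r subnn big1 ?add0r => [e|i _].
    by rewrite /g /= in e; rewrite e eqxx in phil.
  by rewrite (@iter_raise0 _ _ (size ds)) ?mulr0 //; apply: g_lt.
rewrite bc; apply: (IHds _ (g b)) => //.
- by move=> l' sl' /(supp (b :: l')); rewrite /= sl' => /(_ erefl) /andP[].
(* [K - b] is one more than the next weight c + d - 2b. Raising the relation [EM M] another [K - M]
   times brings all relations with c < M <= K to the same total power [K]; they are the d - b + 1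
   values required by [binomial_window]. *)
- move=> l' sl'; pose K := (c.+1 + (d - b))%N.
  have -> : (c + (d - b) - b).+1 = (K - b)%N by rewrite /K; lia.
  apply: (@binomial_window (d - b) b c
    (fun i => iter (K - i) raise (g i) l')) => // [i ib|M /andP[cM MK]].
    by apply: (@iter_raise0 _ _ (size ds)) => //; apply: g_lt.
  have /(@iter_raise0 (K - M) _ _)/(_ _ sl') := fun l' => EM M l' cM.
  rewrite iter_raise_sum => eM; rewrite -[RHS]eM.
  rewrite subnK //.
  pose f i := 'C(M, i)%:R * iter (K - i) raise (g i) l'.
  (* The two sums stop at [d] and at [M]; terms beyond [d] vanish by the support of [phi], those
     beyond [M] by the binomial. *)
  have fd i : (d < i)%N -> f i = 0.
    move=> di; rewrite /f (@iter_raise0 _ _ (size ds)) ?mulr0 //.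
    exact: g_gt.
  have fM i : (M < i)%N -> f i = 0 by move=> Mi; rewrite /f bin_small ?mul0r.
  transitivity (\sum_(0 <= i < d.+1) f i); first by rewrite big_mkord.
  transitivity (\sum_(0 <= i < M.+1) f i).
    have [dM|Md] := leqP d M; first by rewrite (sum_tail0 dM fd).
    by rewrite (sum_tail0 (ltnW Md) fM).
  rewrite big_mkord; apply: eq_bigr => i _; rewrite /f -iterD.
  have iM : (i <= M)%N := ltn_ord i.
  by rewrite addnBA // subnK.
- move=> l' J sl' Jd eqJ ltJ; apply: (lmin (b :: l') J.+1) => //=.
    by rewrite sl'.
  by case=> //= j; apply: eqJ.
Qed.

End BallotSequences.

(** * Polynomials on matrices *)

Lemma all2_leqP (l ds : seq nat) : size l = size ds ->
  reflect (forall j, (j < size ds)%N -> (nth 0 l j <= nth 0 ds j)%N) (all2 leq l ds).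
Proof.
move=> sl; rewrite all2E sl eqxx.
apply: (iffP (all_nthP (0%N, 0%N))) => H j; have := H j;
  by rewrite size_zip sl minnn nth_zip.
Qed.

(** The recursion unwound. With [c] equal to 0, [l] the exponents of row i + 1 and [ds] the sums of
    rows i and i + 1, this is the inequality defining [semistd]. *)
Lemma ballot_sum c ds l J :
  ballot c ds l -> (J < size ds)%N ->
  (\sum_(j < J.+1) nth 0%N l j <= c + \sum_(j < J) (nth 0%N ds j - nth 0%N l j))%N.
Proof.
elim: ds c l J => [|d ds IHds] c [|b l] [|J] //= /andP[bc H] JJ.
  by rewrite big_ord_recl !big_ord0 addn0 /= addn0.
have := IHds _ _ _ H JJ.
rewrite [in X in (_ -> X <= _)%N]big_ord_recl [in X in (_ -> _ <= _ + X)%N]big_ord_recl /=.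
rewrite -/(nth 0%N l) -/(nth 0%N ds).
move: (\sum_(j < J.+1) _)%N (\sum_(j < J) _)%N => A B; lia.
Qed.

Section Multinomials.
Variables (R : nzRingType) (K : nat).
Implicit Types (f : {mpoly R[K]}) (m : 'X_{1..K}) (a b : 'I_K).

Lemma mcoeffMU f a m :
  (f * 'X_a)@_m = if m a == 0%N then 0 else f@_(m - U_(a))%MM.
Proof.
have [ma0|ma_neq0] := eqVneq; last first.
  have e : m = (U_(a) + (m - U_(a)))%MM by rewrite addmC submK // lep1mP.
  by rewrite {1}e mcoeffMX.
apply: memN_msupp_eq0; rewrite (perm_mem (msuppMX _ _)).
by apply/negP => /mapP[m' _ me]; move: ma0; rewrite me mnmDE mnm1E eqxx.
Qed.

Lemma mderivU a b : mderiv a ('X_b : {mpoly R[K]}) = (b == a)%:R.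
Proof.
rewrite mderivX mnm1E; case: eqP => [->|_]; last by rewrite scale0r.
rewrite scale1r (_ : (U_(a) - U_(a))%MM = 0%MM) ?mpolyX0 //.
by apply/mnmP => k; rewrite mnmBE mnm0E subnn.
Qed.

End Multinomials.

Section MatrixPolynomials.
Variables (F : numFieldType) (n : nat).
Notation N := n.+1.
Notation A := {mpoly F[N * N]}.
Implicit Types (f g : A) (m : 'X_{1..N * N}) (i j : 'I_N).

Lemma zidx_proof i j : (j * N + i < N * N)%N.
Proof.
apply: (@leq_trans (j * N + N)); first by rewrite ltn_add2l.
by rewrite -mulSnr leq_mul2r ltn_ord orbT.
Qed.

(* Column by column, so that the order on monomials of equal degree is
   lexicographic with the first column most significant. *)
Definition zidx i j : 'I_(N * N) := Ordinal (zidx_proof i j).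

Definition zrow (k : 'I_(N * N)) : 'I_N := inord (k %% N).
Definition zcol (k : 'I_(N * N)) : 'I_N := inord (k %/ N).

Lemma zidxK k : zidx (zrow k) (zcol k) = k.
Proof.
apply: val_inj; rewrite /= /zrow /zcol !inordK ?ltn_mod //.
  by rewrite -divn_eq.
by rewrite ltn_divLR.
Qed.

Lemma zrowK i j : zrow (zidx i j) = i.
Proof.
by apply: val_inj; rewrite /zrow /= modnMDl modn_small // inord_val.
Qed.

Lemma zcolK i j : zcol (zidx i j) = j.
Proof.
by apply: val_inj; rewrite /zcol /= divnMDl // divn_small // addn0 inord_val.
Qed.

Lemma eq_zidx i j i' j' : (zidx i j == zidx i' j') = (i == i') && (j == j').
Proof.
apply/eqP/andP => [e|[/eqP-> /eqP->//]].
by rewrite -(zrowK i j) -{2}(zcolK i j) e zrowK zcolK !eqxx.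
Qed.

Lemma ltn_zidx i j i' j' :
  (zidx i j < zidx i' j')%N = (j < j')%N || (j == j') && (i < i')%N.
Proof.
have -> : (j == j') = (j == j' :> nat) by [].
move: (ltn_ord i) (ltn_ord i') => /=; case: (ltngtP j j') => [lt|gt|->] iN i'N /=.
- apply: (@leq_trans (j * N + N)); first by rewrite ltn_add2l.
  by rewrite -mulSnr (leq_trans _ (leq_addr _ _)) // leq_mul2r lt orbT.
- apply/negbTE; rewrite -leqNgt.
  apply: (@leq_trans (j' * N + N)); first by rewrite leq_add2l ltnW.
  by rewrite -mulSnr (leq_trans _ (leq_addr _ _)) // leq_mul2r gt orbT.
- by rewrite ltn_add2l.
Qed.

Lemma big_zidx (T : Type) (idx : T) (op : Monoid.com_law idx) (G : 'I_(N * N) -> T) :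
  \big[op/idx]_k G k = \big[op/idx]_i \big[op/idx]_j G (zidx i j).
Proof.
rewrite pair_bigA /= (reindex (fun p : 'I_N * 'I_N => zidx p.1 p.2)) //=.
exists (fun k => (zrow k, zcol k)) => [[i j]|k] _ /=; last exact: zidxK.
by rewrite zrowK zcolK.
Qed.

Notation z i j := ('X_(zidx i j) : A).
Notation dz i j := (mderiv (zidx i j)).

(** Polarization operators, the infinitesimal left ([Drow]) and right ([Ecol]) multiplications on
    matrices. *)
Definition Drow i i' f : A := \sum_j z i j * dz i' j f.
Definition Ecol j j' f : A := \sum_i z i j * dz i j' f.

Lemma mcoeff_move (a b : 'I_(N * N)) f m :
  ('X_a * mderiv b f)@_m =
  if m a == 0%N then 0
  else f@_(m - U_(a) + U_(b))%MM *+ ((m - U_(a))%MM b).+1.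
Proof. by rewrite mulrC mcoeffMU mcoeff_deriv. Qed.

Definition ent m (i j : nat) : nat := m (zidx (inord i) (inord j)).
Definition psum m (i J : nat) : nat := (\sum_(j < J) ent m i j)%N.

Lemma entE m i j : ent m i j = m (zidx i j).
Proof. by rewrite /ent !inord_val. Qed.

(* Exponent matrices of the semistandard tableaux: ent m i j is the number of
   letters j in row i. *)
Definition semistd m : Prop :=
  forall i J : nat, (i < n)%N -> (J <= n)%N -> (psum m i.+1 J.+1 <= psum m i J)%N.

Lemma ltmc_zidx m m' i j : mdeg m = mdeg m' ->
  (forall i' j', (j' < j)%N || (j' == j) && (i' < i)%N ->
     m (zidx i' j') = m' (zidx i' j')) ->
  (m (zidx i j) < m' (zidx i j))%N -> (m < m')%O.
Proof.
move=> dm eq_m lt_m; apply/ltmcP => //; exists (zidx i j) => // k.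
by rewrite -(zidxK k) ltn_zidx => /eq_m.
Qed.

(* Only the rows i and i + 1 matter. Freezing the other exponents and the sum
   d_j of the two exponents in each column j, the coefficients of f, rescaled by
   factorials, become a function of the exponents l_j of row i + 1, and Drow
   becomes the operator [raise]. *)
Lemma mlead_semistd f : f != 0 ->
  (forall i i', i' = i.+1 :> nat -> Drow i i' f = 0) -> semistd (mlead f).
Proof.
move=> f_neq0 Df i0 J i0n Jn; set mo := mlead f.
pose i : 'I_N := inord i0; pose i' : 'I_N := inord i0.+1.
have vi : i = i0 :> nat by rewrite inordK // ltnW.
have vi' : i' = i0.+1 :> nat by rewrite inordK.
have neq_i : (i' == i) = false by apply/eqP => /(congr1 val); rewrite /= vi vi'; lia.
pose ds := mkseq (fun j : nat => ent mo i0 j + ent mo i0.+1 j)%N N.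
pose ls := mkseq (ent mo i0.+1) N.
pose mon (l : seq nat) : 'X_{1..N * N} := [multinom
  if zrow k == i then nth 0%N ds (zcol k) - nth 0%N l (zcol k)
  else if zrow k == i' then nth 0%N l (zcol k) else mo k | k < N * N]%N.
(* The guard excludes the indices for which the subtraction in [mon] would be truncated. *)
pose phi l : F := if all2 leq l ds
  then (\prod_(j < N) (nth 0%N l j)`!)%:R * f@_(mon l) else 0.
have size_ds : size ds = N by rewrite size_mkseq.
have size_ls : size ls = N by rewrite size_mkseq.
have all2P l : size l = N ->
    reflect (forall j : 'I_N, nth 0 l j <= nth 0 ds j)%N (all2 leq l ds).
  move=> sl; apply: (iffP (all2_leqP _)) => [|H j|H j jN]; rewrite ?sl //.
    by apply: H; rewrite size_ds.
  by rewrite size_ds in jN; apply: (H (Ordinal jN)).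
have mon_i l j : mon l (zidx i j) = (nth 0 ds j - nth 0 l j)%N.
  by rewrite mnmE zrowK zcolK eqxx.
have mon_i' l j : mon l (zidx i' j) = nth 0%N l j.
  by rewrite mnmE zrowK zcolK neq_i eqxx.
have mon_o l i1 j : i1 != i -> i1 != i' -> mon l (zidx i1 j) = mo (zidx i1 j).
  by move=> /negbTE a /negbTE b; rewrite mnmE zrowK a b.
have dsE (j : 'I_N) : nth 0%N ds j = (mo (zidx i j) + mo (zidx i' j))%N.
  by rewrite nth_mkseq // /ent !inord_val.
have lsE (j : 'I_N) : nth 0%N ls j = mo (zidx i' j).
  by rewrite nth_mkseq // /ent !inord_val.
have monls : mon ls = mo.
  apply/mnmP => k; rewrite -(zidxK k); set j := zcol k.
  have [->|ni] := eqVneq (zrow k) i; first by rewrite mon_i dsE lsE addnK.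
  have [->|ni'] := eqVneq (zrow k) i'; first by rewrite mon_i' lsE.
  by rewrite mon_o.
(* The initial weight is 0 because a single application of the operator already kills [f]. *)
have := @ballot_lexmin F ds 0 phi ls; rewrite size_ls size_ds => bal.
have {}bal : ballot 0 ds ls.
  apply: bal => // [l sl|l sl||l J' sl J'N eq_l lt_l].
  - by rewrite /phi; case: ifP => //; rewrite eqxx.
  - rewrite /= /raise sl /phi.
    have nth_incr (j j' : 'I_N) :
        nth 0%N (incr_nth l j) j' = ((j == j') + nth 0%N l j')%N.
      by rewrite nth_incr_nth.
    case: (all2P l sl) => [le_l|nle_l]; last first.
      apply: big1 => j _; case: (all2P (incr_nth l j)) => //.
        by rewrite size_incr_nth sl ltn_ord.
      move=> H; case: nle_l => j'; apply: leq_trans (H j').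
      by rewrite nth_incr leq_addl.
    have := congr1 (mcoeff (mon l)) (Df i i' _).
    rewrite vi vi' mcoeff0 raddf_sum /= => /(_ erefl) D0.
    transitivity ((\prod_(j < N) (nth 0%N l j)`!)%:R *
      \sum_j ('X_(zidx i j) * mderiv (zidx i' j) f)@_(mon l)); last by rewrite D0 mulr0.
    rewrite mulr_sumr; apply: eq_bigr => j _; rewrite mcoeff_move mon_i subn_eq0.
    have [le_j|gt_j] := leqP.
      case: (all2P (incr_nth l j)) => [||_]; rewrite ?mulr0 ?size_incr_nth ?sl ?ltn_ord //.
      by move=> /(_ j); rewrite nth_incr eqxx ltnNge le_j.
    case: (all2P (incr_nth l j)) => [||[]]; rewrite ?size_incr_nth ?sl ?ltn_ord //; last first.
      by move=> j'; rewrite nth_incr; case: eqP => [<-//|_]; apply: le_l.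
    move=> _; have -> : (mon l - U_(zidx i j) + U_(zidx i' j))%MM = mon (incr_nth l j).
      apply/mnmP => k; rewrite -(zidxK k) mnmDE mnmBE !mnm1E !eq_zidx.
      have [->|ni] := eqVneq (zrow k) i.
        by rewrite neq_i /= !mon_i nth_incr addn0 -subnDA addnC.
      rewrite /= subn0; have [->|ni'] := eqVneq (zrow k) i'.
        by rewrite /= !mon_i' nth_incr addnC.
      by rewrite /= addn0 !mon_o.
    have -> : (mon l - U_(zidx i j))%MM (zidx i' j) = nth 0%N l j.
      by rewrite mnmBE mon_i' mnm1E eq_zidx [i == _]eq_sym neq_i subn0.
    rewrite -[f@_ _ *+ _]mulr_natl mulrA -natrM; congr (_%:R * _).
    rewrite (bigD1 j) //= [in RHS](bigD1 j) //= nth_incr eqxx /= factS.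
    rewrite [RHS]mulnC [RHS]mulnA; congr (_ * _)%N.
    by apply: eq_bigr => j' nj; rewrite nth_incr eq_sym (negbTE nj).
  - rewrite /phi monls.
    have -> : all2 leq ls ds by apply/all2P => // j; rewrite dsE lsE leq_addl.
    rewrite mulf_neq0 // ?mleadc_eq0 // pnatr_eq0 -lt0n prodn_gt0 // => j.
    exact: fact_gt0.
  (* Within a column, row i precedes row i + 1 in the monomial order, and its exponent is [ds - l].
     Hence a lexicographically smaller [l] gives a larger monomial, which is absent beyond the
     leading one. *)
  - rewrite /phi; case: (all2P l sl) => // le_l.
    rewrite mcoeff_gt_mlead ?mulr0 // -/mo.
    apply: (@ltmc_zidx _ _ i (Ordinal J'N)).
    + rewrite !mdegE !big_zidx; rewrite exchange_big [RHS]exchange_big.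
      apply: eq_bigr => j _.
      rewrite (bigD1 i) //= (bigD1 i') ?neq_i //= addnA.
      rewrite [RHS](bigD1 i) //= [in RHS](bigD1 i') ?neq_i //= addnA.
      rewrite mon_i mon_i' subnK // dsE; congr (_ + _)%N.
      by apply: eq_bigr => i1 /andP[ni ni']; rewrite mon_o.
    + move=> i1 j lt_j; have [e|ni] := eqVneq i1 i.
        by move: lt_j; rewrite e ltnn andbF orbF mon_i => /eq_l ->; rewrite dsE lsE addnK.
      have [e|ni'] := eqVneq i1 i'; last by rewrite mon_o.
      have i'i : (i' < i)%N = false by rewrite vi vi' ltnNge leqnSn.
      move: lt_j; rewrite e i'i andbF orbF mon_i' => /eq_l ->.
      by rewrite lsE.
    + rewrite mon_i -[mo _](addnK (mo (zidx i' (Ordinal J'N)))) -dsE -lsE.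
      by apply: ltn_sub2l => //; apply: leq_trans lt_l _;
      rewrite (lsE (Ordinal J'N)) (dsE (Ordinal J'N)) leq_addl.
have := ballot_sum bal _; rewrite size_ds => /(_ J Jn).
rewrite add0n /psum => H; apply: leq_trans (leq_trans H _).
  by apply: leq_sum => j _; rewrite nth_mkseq // (leq_trans (ltn_ord j)).
apply: leq_sum => j _; rewrite !nth_mkseq; try by rewrite (leq_trans (ltn_ord j)) // leqW.
by rewrite addnK.
Qed.

Lemma Drow_is_linear i i' : linear (Drow i i').
Proof.
move=> c f g; rewrite /Drow scaler_sumr -big_split; apply: eq_bigr => j _.
by rewrite linearP mulrDr scalerAr.
Qed.
HB.instance Definition _ i i' :=
  GRing.isLinear.Build F A A *:%R (Drow i i') (Drow_is_linear i i').

Lemma Ecol_is_linear j j' : linear (Ecol j j').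
Proof.
move=> c f g; rewrite /Ecol scaler_sumr -big_split; apply: eq_bigr => i _.
by rewrite linearP mulrDr scalerAr.
Qed.
HB.instance Definition _ j j' :=
  GRing.isLinear.Build F A A *:%R (Ecol j j') (Ecol_is_linear j j').

Lemma DrowM i i' f g : Drow i i' (f * g) = Drow i i' f * g + f * Drow i i' g.
Proof.
rewrite /Drow mulr_suml mulr_sumr -big_split; apply: eq_bigr => j _ /=.
by rewrite mderivM mulrDr; congr (_ + _); [apply: mulrA | apply: mulrCA].
Qed.

Lemma Drow_z i i' a b : Drow i i' (z a b) = (a == i')%:R *: z i b.
Proof.
rewrite /Drow (bigD1 b) //= big1 ?addr0 => [|j jb]; rewrite mderivU eq_zidx.
  by rewrite eqxx andbT; case: eqP => _; rewrite ?mulr1 ?scale1r ?mulr0 ?scale0r.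
by rewrite [b == j]eq_sym (negbTE jb) andbF mulr0.
Qed.

(** Left and right multiplications commute: both compositions have the first-order term
    [z i a * dz i' b f] and the same second-order part. *)
Lemma Drow_Ecol i i' a b f : Drow i i' (Ecol a b f) = Ecol a b (Drow i i' f).
Proof.
transitivity (z i a * dz i' b f
  + \sum_j \sum_p z i j * (z p a * dz i' j (dz p b f))).
  rewrite /Drow /Ecol; under eq_bigr => j _.
    rewrite raddf_sum mulr_sumr /=.
    under eq_bigr => p _ do rewrite mderivM mderivU eq_zidx mulrDr.
    rewrite big_split /=.
    over.
  rewrite big_split /=; congr (_ + _).
  rewrite (bigD1 a) //= (bigD1 i') //= !eqxx mul1r.
  rewrite [X in _ + X + _]big1 => [|p /negbTE ->]; rewrite ?mul0r ?mulr0 //.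
  rewrite addr0 [X in _ + X]big1 ?addr0 // => j ja.
  by rewrite big1 // => p _; rewrite [a == j]eq_sym (negbTE ja) andbF mul0r mulr0.
symmetry; rewrite /Drow /Ecol; under eq_bigr => p _.
  rewrite raddf_sum mulr_sumr /=.
  under eq_bigr => j _ do rewrite mderivM mderivU eq_zidx mulrDr.
  rewrite big_split /=.
  over.
rewrite big_split /=; congr (_ + _).
  rewrite (bigD1 i) //= (bigD1 b) //= !eqxx mul1r.
  rewrite [X in _ + X + _]big1 => [|j /negbTE jb]; last first.
    by rewrite jb andbF mul0r mulr0.
  rewrite addr0 [X in _ + X]big1 ?addr0 // => p /negbTE pi.
  by rewrite big1 // => j _; rewrite [i == p]eq_sym pi mul0r mulr0.
rewrite exchange_big; apply: eq_bigr => j _; apply: eq_bigr => p _ /=.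
by rewrite mulrCA mderiv_comm.
Qed.

End MatrixPolynomials.

(** * Highest weight vectors for the row operators, and products of minors *)

Section HighestWeight.
Variables (F : numFieldType) (n : nat).
Notation N := n.+1.
Notation A := {mpoly F[N * N]}.
Notation z i j := ('X_(zidx i j) : A).
Notation dz i j := (mderiv (zidx i j)).
Implicit Types (f g : A) (m : 'X_{1..N * N}) (i j : 'I_N).

(* Vectors of highest weight lam for the row operators; they form a copy of the
   irreducible gl(N)-module of highest weight lam under the column operators. *)
Definition isL (lam : nat -> nat) f : Prop := forall i i', (i <= i')%N ->
  Drow i i' f = (if i == i' then (lam i)%:R else 0) *: f.

Lemma isL0 lam : isL lam 0.
Proof. by move=> i i' _; rewrite linear0 scaler0. Qed.

Lemma isL_lin lam c f g : isL lam f -> isL lam g -> isL lam (c *: f + g).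
Proof.
by move=> Lf Lg i i' ii'; rewrite linearP /= Lf // Lg // scalerDr !scalerA mulrC.
Qed.

Lemma isLZ lam c f : isL lam f -> isL lam (c *: f).
Proof. by move=> Lf; rewrite -[_ *: _]addr0; apply: isL_lin => //; apply: isL0. Qed.

Lemma isL_sum lam (I : Type) (r : seq I) (P : pred I) (G : I -> A) :
  (forall t, isL lam (G t)) -> isL lam (\sum_(t <- r | P t) G t).
Proof.
move=> LG; elim/big_ind: _ => // [|f g Lf Lg]; first exact: isL0.
by rewrite -[f]scale1r; apply: isL_lin.
Qed.

Lemma isL_E lam j j' f : isL lam f -> isL lam (Ecol j j' f).
Proof. by move=> Lf i i' ii'; rewrite Drow_Ecol Lf // linearZ. Qed.

Lemma isLM lam mu f g :
  isL lam f -> isL mu g -> isL (fun i : nat => lam i + mu i)%N (f * g).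
Proof.
move=> Lf Lg i i' ii'; rewrite DrowM Lf // Lg //.
case: ifP => _; last by rewrite !scale0r mul0r mulr0 addr0.
by rewrite -scalerAl -scalerAr -scalerDl natrD.
Qed.

Lemma eq_isL (lam mu : nat -> nat) f : (forall i, lam i = mu i) -> isL lam f -> isL mu f.
Proof. by move=> e Lf i i' ii'; rewrite Lf // e. Qed.

Lemma mcoeff_Drow_diag i f m : (Drow i i f)@_m = (psum m i N)%:R * f@_m.
Proof.
rewrite raddf_sum /psum natr_sum mulr_suml; apply: eq_bigr => j _ /=.
rewrite mcoeff_move entE; case: eqP => [->|/eqP m0]; first by rewrite mul0r.
rewrite submK ?lep1mP // mnmBE mnm1E eqxx subn1 prednK ?lt0n //.
by rewrite mulr_natl.
Qed.

Lemma isL_psum lam f m i : isL lam f -> m \in msupp f -> psum m i N = lam i.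
Proof.
move=> Lf; rewrite mcoeff_msupp => fm.
have := congr1 (mcoeff m) (Lf i i (leqnn i)).
rewrite eqxx mcoeff_Drow_diag mcoeffZ => /(mulIf fm)/eqP.
by rewrite eqr_nat => /eqP.
Qed.

Lemma mdeg_psum m : mdeg m = (\sum_(i < N) psum m i N)%N.
Proof.
rewrite mdegE big_zidx; apply: eq_bigr => i _.
by apply: eq_bigr => j _; rewrite entE.
Qed.

Lemma isL_semistd lam f : isL lam f -> f != 0 -> semistd (mlead f).
Proof.
move=> Lf f0; apply: mlead_semistd => // i i' ii'; rewrite Lf ?ii' //.
by case: eqP ii' => [->|_ _]; [lia | rewrite scale0r].
Qed.

Lemma mlead_eq f m :
  f@_m != 0 -> (forall m', m' \in msupp f -> (m' <= m)%O) -> mlead f = m.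
Proof.
move=> fm le_m; apply: le_anti; rewrite le_m; last first.
  by apply: mlead_supp; apply: contraNneq fm => ->; rewrite mcoeff0.
by apply: msupp_le_mlead; rewrite mcoeff_msupp.
Qed.

Definition colsum m j : nat := (\sum_i m (zidx i j))%N.

Lemma Drow1 i i' : Drow i i' (1 : A) = 0.
Proof. by apply: big1 => j _; rewrite -mpolyC1 mderivC mulr0. Qed.

Section Minors.
Variables (q : nat) (I : 'I_q -> 'I_N).
Hypothesis qN : (q <= N)%N.

Definition minor : A := \det (\matrix_(r < q, s < q) z (inord r) (I s)).
Definition minor_mon (s : 'S_q) : 'X_{1..N * N} :=
  (\sum_(r < q) U_(zidx (inord r) (I (s r))))%MM.

Lemma minorE : minor = \sum_(s : 'S_q) (-1) ^+ s *: 'X_[minor_mon s].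
Proof.
apply: eq_bigr => s _; rewrite /minor_mon -mprodXE.
case: (odd_perm s) => /=; rewrite ?expr0 ?expr1 ?mul1r ?scale1r ?mulN1r ?scaleN1r.
  by congr (- _); apply: eq_bigr => r _; rewrite mxE.
by apply: eq_bigr => r _; rewrite mxE.
Qed.

Lemma ltqN (r : 'I_q) : (r < N)%N.
Proof. exact: leq_trans qN. Qed.

Lemma inord_inj_q (r r' : 'I_q) : (inord r == inord r' :> 'I_N) = (r == r').
Proof.
apply/eqP/eqP => [/(congr1 val)|->//] /=.
by rewrite !inordK ?ltqN // => /val_inj.
Qed.

(** The derivation replaces row i' by row i in the determinant. This changes nothing if they are
    equal, produces two equal rows if i < i' < q, and gives 0 if row i' does not occur in the
    minor. *)
Lemma isL_minor : isL (fun i : nat => ((i < q)%N : nat)) minor.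
Proof.
move=> i i' ii'.
have D_prod s (P : pred 'I_q) : (forall r, P r -> inord r != i') ->
    Drow i i' (\prod_(r | P r) z (inord r) (I (s r))) = 0.
  move=> Pi; elim/big_ind: _ => [|f g Df Dg|r /Pi /negbTE ri].
  - exact: Drow1.
  - by rewrite DrowM Df Dg mul0r mulr0 addr0.
  - by rewrite Drow_z ri scale0r.
rewrite raddf_sum /=; have [i'q|qi'] := ltnP i' q; last first.
  rewrite big1 => [|s _].
    case: eqP => [->|_]; last by rewrite scale0r.
    by rewrite ltnNge qi' scale0r.
  under [X in _ * X]eq_bigr => r _ do rewrite mxE.
  case: (odd_perm s); rewrite /= ?expr1 ?expr0 ?mulN1r ?mul1r ?linearN /= D_prod ?oppr0 // => r _;
    by apply/eqP => /(congr1 val) /=; rewrite inordK ?ltqN //;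
       have := ltn_ord r; lia.
pose r0 := Ordinal i'q.
have r0i' : inord r0 = i' by rewrite /= inord_val.
pose M := \matrix_(r < q, s < q) z (if r == r0 then i else inord r) (I s).
transitivity (\det M).
  apply: eq_bigr => s _.
  have e : Drow i i' (\prod_r
      (\matrix_(r, s) z (inord r) (I s)) r (s r)) = \prod_r M r (s r).
    under eq_bigr => r _ do rewrite mxE.
    rewrite (bigD1 r0) //= DrowM Drow_z r0i' eqxx scale1r D_prod ?mulr0 ?addr0.
      rewrite [RHS](bigD1 r0) //= mxE eqxx; congr (_ * _).
      by apply: eq_bigr => r /negbTE rr0; rewrite mxE rr0.
    by move=> r rr0; rewrite -r0i' inord_inj_q.
  by case: (odd_perm s); rewrite /= ?expr1 ?expr0 ?mulN1r ?mul1r ?linearN /= e.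
have [e|ni] := eqVneq i i'.
  rewrite e i'q scale1r; congr (\det _); apply/matrixP => r s; rewrite !mxE.
  by case: eqP => // ->; rewrite e r0i'.
have iq : (i < q)%N by apply: leq_ltn_trans ii' _.
rewrite scale0r; apply: (@determinant_alternate _ _ _ (Ordinal iq) r0).
  by apply: contraNneq ni => /(congr1 val) /= /val_inj ->.
move=> s; rewrite !mxE eqxx; case: eqP => // _.
by congr (z _ _); rewrite /= inord_val.
Qed.

Hypothesis I_inj : {mono I : r s / (r < s)%N}.

Lemma minor_monE (s : 'S_q) i (t : 'I_q) :
  minor_mon s (zidx i (I t)) = (inord ((s^-1)%g t) == i).
Proof.
have I_injective : injective I.
  move=> r r' e; apply: val_inj => /=.
  by have := I_inj r r'; have := I_inj r' r; rewrite e ltnn; lia.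
rewrite /minor_mon mnm_sumE (bigD1 ((s^-1)%g t)) //= permKV mnm1E eq_zidx eqxx andbT.
rewrite big1 ?addn0 // => r rt; rewrite mnm1E eq_zidx.
rewrite (inj_eq I_injective) (can2_eq (permK s) (permKV s)).
by rewrite (negbTE rt) andbF.
Qed.

Lemma minor_mon_out (s : 'S_q) i j :
  (forall t, I t != j) -> minor_mon s (zidx i j) = 0%N.
Proof.
move=> nj; rewrite /minor_mon mnm_sumE big1 // => r _.
by rewrite mnm1E eq_zidx (negbTE (nj _)) andbF.
Qed.

Lemma mdeg_minor_mon s : mdeg (minor_mon s) = q.
Proof.
by rewrite mdeg_sum (eq_bigr (fun=> 1%N)) ?sum1_card ?card_ord // => r; rewrite mdeg1.
Qed.

Lemma colsum_minor_mon s j : colsum (minor_mon s) j = (\sum_t (I t == j))%N.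
Proof.
rewrite /colsum /minor_mon; under eq_bigr do rewrite mnm_sumE.
rewrite exchange_big [RHS](reindex_inj (@perm_inj _ s)) /=.
apply: eq_bigr => r _; rewrite (bigD1 (inord r)) //= mnm1E eq_zidx eqxx /=.
by rewrite big1 ?addn0 // => i; rewrite mnm1E eq_zidx eq_sym => /negbTE ->.
Qed.

(** Let t be the least index moved by [s]. The columns before [I t] agree; in column [I t] the
    diagonal term has its variable in row t, the other one in the later row [(s^-1)%g t]. *)
Lemma lt_minor_mon (s : 'S_q) : s != 1%g -> (minor_mon s < minor_mon 1)%O.
Proof.
move=> s1.
have [t0 st0] : exists t, s t != t.
  apply/existsP; apply: contraNT s1; rewrite negb_exists => /forallP H.
  by apply/eqP/permP => t; rewrite perm1; apply/eqP; have := H t; rewrite negbK.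
have [t st tmin] := @arg_minnP _ t0 (fun t => s t != t) (fun t : 'I_q => nat_of_ord t) st0.
have fixed (t' : 'I_q) : (t' < t)%N -> s t' = t'.
  move=> t't; apply/eqP; rewrite -[_ == _]negbK; apply/negP => /tmin.
  by rewrite leqNgt t't.
apply: (@ltmc_zidx n _ _ (inord t) (I t)); rewrite ?mdeg_minor_mon //; last first.
  rewrite !minor_monE invg1 perm1 eqxx inord_inj_q.
  by rewrite eq_sym -(can2_eq (permK s) (permKV s)) (negbTE st).
move=> i j lt_ij; have [/existsP[t' /eqP e]|] := boolP [exists t', I t' == j]; last first.
  by rewrite negb_exists => /forallP nj; rewrite !minor_mon_out.
move: lt_ij; rewrite -e !minor_monE invg1 perm1 I_inj => /orP[/fixed|/andP[]].
  by move=> st'; rewrite -{1}st' permK.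
move=> /eqP It it; have {It} -> : t' = t.
  apply: val_inj => /=.
  by have := I_inj t t'; have := I_inj t' t; rewrite It !ltnn; lia.
move: it; rewrite inordK ?ltqN // => it.
have -> : (inord t == i) = false.
  by apply/eqP => e'; move: it; rewrite -e' inordK ?ltqN // ltnn.
apply/eqP; rewrite eqb0; apply/eqP => e'.
have iq : ((s^-1)%g t < t)%N.
  by move: it; rewrite -e' inordK ?ltqN.
by have := fixed _ iq; rewrite permKV => e2; rewrite -e2 ltnn in iq.
Qed.

Lemma minor_coef : minor@_(minor_mon 1) = 1.
Proof.
rewrite minorE raddf_sum (bigD1 1%g) //= mcoeffZ mcoeffX eqxx odd_perm1 expr0 mul1r.
rewrite big1 ?addr0 // => s /lt_minor_mon lt_s.
by rewrite mcoeffZ mcoeffX (lt_eqF lt_s) mulr0.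
Qed.

Lemma msupp_minor m : m \in msupp minor -> exists s, m = minor_mon s.
Proof.
rewrite minorE => /msupp_sum_le /flattenP[x /mapP[s _ ->]] /msuppZ_le.
by rewrite msuppX inE => /eqP ->; exists s.
Qed.

Lemma minor_neq0 : minor != 0.
Proof. by apply: contra_eq_neq minor_coef => ->; rewrite mcoeff0 eq_sym oner_neq0. Qed.

Lemma mlead_minor : mlead minor = minor_mon 1.
Proof.
apply: mlead_eq => [|m' /msupp_minor[s ->]]; first by rewrite minor_coef oner_neq0.
by have [->//|/lt_minor_mon/ltW] := eqVneq s 1%g.
Qed.

End Minors.

(* Multiply the minors on the columns of the tableau, the first column being
   peeled off at each step: row i loses its first letter. *)
Lemma exists_tableau_vector a : semistd a -> exists g,
  [/\ isL (psum a ^~ N) g, g != 0, mlead g = a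
    & forall m, m \in msupp g -> forall j, colsum m j = colsum a j].
Proof.
have [d] := ubnP (mdeg a); elim: d a => // d IHd a; rewrite ltnS => da std_a.
have [a0|a0] := eqVneq a 0%MM.
  exists 1; split; rewrite ?oner_neq0 ?mlead1 //.
    move=> i i' ii'; rewrite Drow1 a0 /psum big1 ?if_same ?scale0r // => j _.
    by rewrite /ent mnm0E.
  by move=> m; rewrite -mpolyC1 msuppC oner_eq0 inE a0 => /eqP ->.
have psumS (i J : nat) : psum a i J.+1 = (psum a i J + ent a i J)%N.
  by rewrite /psum big_ord_recr.
have psum_mono (i J J' : nat) : (J <= J')%N -> (psum a i J <= psum a i J')%N.
  by move=> /subnK <-; elim: (J' - J)%N => //= p IHp; rewrite addSn psumS (leq_trans IHp) ?leq_addr.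
pose rs (i : nat) := psum a i N.
have rs_dec (i : nat) : (i < n)%N -> (rs i.+1 <= rs i)%N.
  by move=> i_n; apply: leq_trans (std_a i n i_n (leqnn n)) (psum_mono _ _ _ (leqnSn n)).
have rs_out (i i' : nat) : (i <= i')%N -> (i' <= n)%N -> rs i = 0%N -> rs i' = 0%N.
  move=> /subnK <-; elim: (i' - i)%N => // p IHp pn ri.
  by apply/eqP; rewrite -leqn0 -(IHp (ltnW pn) ri) rs_dec.
(* The number of nonempty rows, which is the height of the first column of the tableau. *)
pose q := find (fun i : nat => rs i == 0%N) (iota 0 N).
have qN : (q <= N)%N by rewrite -[N in (_ <= N)%N](size_iota 0) find_size.
have rs_q (i : nat) : (i < N)%N -> (0 < rs i)%N = (i < q)%N.
  move=> iN; have [iq|qi] := ltnP i q.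
    by have := before_find 0%N iq; rewrite nth_iota // add0n lt0n => ->.
  apply/negbTE; rewrite -leqNgt leqn0; apply/eqP; apply: (@rs_out q) => //.
  have qN' : (q < N)%N by apply: leq_ltn_trans iN.
  have : has (fun i : nat => rs i == 0%N) (iota 0 N) by rewrite has_find size_iota.
  by move/(nth_find 0%N); rewrite nth_iota // => /eqP.
(* The smallest letter of row i. Column strictness makes it increase with i, so that the letters
   form a valid column set for a minor. *)
pose fst (i : nat) := find (fun j : nat => 0 < ent a i j)%N (iota 0 N).
have fst_psum (i J : nat) : (J <= N)%N -> (0 < psum a i J)%N = (fst i < J)%N.
  move=> JN; rewrite lt0n sum_nat_eq0 negb_forall; apply/existsP/idP => [[j]|fJ].
    rewrite /= -lt0n => aj; rewrite ltnNge; apply/negP => Jf.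
    have := before_find 0%N (leq_trans (ltn_ord j) Jf).
    by rewrite nth_iota ?add0n ?aj // (leq_trans (ltn_ord j)).
  exists (Ordinal fJ); rewrite /= -lt0n.
  have : has (fun j : nat => 0 < ent a i j)%N (iota 0 N).
    by rewrite has_find size_iota (leq_trans fJ).
  by move/(nth_find 0%N); rewrite nth_iota // (leq_trans fJ).
pose I (r : 'I_q) : 'I_N := inord (fst r).
have fstN (i : nat) : (i < q)%N -> (fst i < N)%N.
  by move=> iq; rewrite -fst_psum // [psum _ _ _ in X in is_true X]/(rs i) rs_q // (leq_trans iq).
have fstS (i : nat) : (i.+1 < q)%N -> (fst i < fst i.+1)%N.
  move=> iq; have i_n : (i < n)%N by rewrite -ltnS (leq_trans iq).
  have fn : (fst i.+1 <= n)%N by rewrite -ltnS fstN.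
  rewrite -fst_psum ?(leq_trans fn) //; apply: leq_trans (std_a i _ i_n fn).
  by rewrite fst_psum.
have fst_lt (r s : nat) : (r < s)%N -> (s < q)%N -> (fst r < fst s)%N.
  move=> /subnK <-; elim: (s - r.+1)%N => [|p IHp] pq; first exact: fstS.
  by rewrite addSn (ltn_trans (IHp _)) ?fstS // ltnW.
have I_mono : {mono I : r s / (r < s)%N}.
  move=> r s; rewrite /I !inordK ?fstN //.
  have [rs'|sr|e] := ltngtP (r : nat) s.
  - by rewrite fst_lt.
  - by apply/negbTE; rewrite -leqNgt ltnW // fst_lt.
  - by rewrite e ltnn.
pose b := minor_mon I 1.
(* Since the letter removed is the smallest of its row, every positive partial sum drops by 1, and
   passing to predecessors preserves the inequalities of [semistd]. *)
have psum_b (i J : nat) : (i < N)%N -> (J <= N)%N -> psum b i J = (0 < psum a i J)%N.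
  move=> iN JN; rewrite fst_psum // /psum.
  have [iq|qi] := ltnP i q; last first.
    rewrite big1 => [|j _].
      apply/esym/eqP; rewrite eqb0 -fst_psum // -leqNgt.
      apply: leq_trans (psum_mono i _ _ JN) _.
      by rewrite leqNgt -[psum a i N]/(rs i) rs_q // -leqNgt.
    rewrite /ent /b /minor_mon mnm_sumE big1 // => r _.
    rewrite mnm1E eq_zidx; case: eqP => // /(congr1 val).
    by rewrite /= !inordK ?(leq_trans (ltn_ord r)) // => ri; move: (ltn_ord r); rewrite ri ltnNge qi.
  have entb (j : nat) : (j < N)%N -> ent b i j = (fst i == j).
    move=> jN; rewrite /ent /b /minor_mon mnm_sumE (bigD1 (Ordinal iq)) //=.
    rewrite mnm1E eq_zidx eqxx perm1 /= big1 ?addn0 => [|r].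
      congr nat_of_bool; apply/eqP/eqP => [/(congr1 val)|e] /=.
        by rewrite !inordK ?fstN.
      by apply: val_inj; rewrite /= !inordK ?fstN.
    move=> ri; rewrite mnm1E eq_zidx; case: eqP => // /(congr1 val).
    rewrite /= !inordK ?(leq_trans (ltn_ord r)) // => e.
    by case/eqP: ri; apply: val_inj.
  rewrite (eq_bigr (fun j : 'I_J => (fst i == j) : nat)) => [|j _]; last first.
    by rewrite entb // (leq_trans (ltn_ord j)).
  have [fJ|Jf] := ltnP (fst i) J.
    rewrite (bigD1 (Ordinal fJ)) //= eqxx big1 // => j jf.
    by case: eqP => // e; case/eqP: jf; apply: val_inj; rewrite /= e.
  by rewrite big1 // => j _; case: eqP => // e; move: (ltn_ord j); rewrite -e ltnNge Jf.
have le_ba : (b <= a)%MM.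
  apply/mnm_lepP => k; rewrite -(zidxK k) -!entE; move: (zrow k) (zcol k) => i j.
  have := psum_b i j (ltn_ord i) (ltnW (ltn_ord j)); have := psum_b i j.+1 (ltn_ord i) (ltn_ord j).
  rewrite psumS [psum b _ _.+1]/psum big_ord_recr /= -/(psum b i j).
  by move: (psum b i j) (psum a i j) => x y; lia.
pose a' := (a - b)%MM.
have psum_a' (i J : nat) : (i < N)%N -> (J <= N)%N -> psum a' i J = (psum a i J).-1.
  move=> iN JN; rewrite /psum (eq_bigr (fun j : 'I_J => ent a i j - ent b i j)%N); last first.
    by move=> j _; rewrite /ent mnmBE.
  rewrite sumnB => [|j _]; last exact: (mnm_lepP le_ba).
  by rewrite -/(psum a i J) -/(psum b i J) psum_b //; lia.
have std_a' : semistd a'.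
  move=> i J i_n Jn; rewrite !psum_a' ?(leq_trans Jn) //; last exact: ltnW.
  by have := std_a i J i_n Jn; lia.
have aE : a = (a' + b)%MM by rewrite submK.
have q_gt0 : (0 < q)%N.
  rewrite lt0n; apply: contra a0 => /eqP q0; rewrite -mdeg_eq0 mdeg_psum sum_nat_eq0.
  by apply/forallP => i; rewrite -leqn0 leqNgt -[psum a i N]/(rs i) rs_q // q0.
have [|g [Lg g0 lead_g col_g]] := IHd a' _ std_a'.
  by apply: leq_trans da; rewrite [in X in (_ < X)%N]aE mdegD mdeg_minor_mon; lia.
exists (g * minor I); split.
- apply: (@eq_isL (fun i : nat => psum a' i N + (i < q))%N); last by apply: isLM Lg _; apply: isL_minor.
  by move=> i; rewrite psum_a' // -rs_q // /rs; lia.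
- by rewrite mulf_neq0 // minor_neq0.
- by rewrite mleadM ?minor_neq0 // lead_g mlead_minor // aE.
- move=> m /msuppM_le /allpairsP[[m1 m2] /= [m1g /msupp_minor[s m2E] ->]] j.
  have colD (x y : 'X_{1..N * N}) : colsum (x + y)%MM j = (colsum x j + colsum y j)%N.
    by rewrite /colsum -big_split; apply: eq_bigr => i _; rewrite mnmDE.
  by rewrite aE !colD m2E !colsum_minor_mon // (col_g _ m1g).
Qed.

End HighestWeight.

(** * Highest weight vectors and the Fischer inner product *)

Section HighestWeightVectors.
Variables (F : numFieldType) (n : nat).
Notation N := n.+1.
Notation A := {mpoly F[N * N]}.
Notation z i j := ('X_(zidx i j) : A).
Notation dz i j := (mderiv (zidx i j)).
Implicit Types (f g v w : A) (m : 'X_{1..N * N}) (i j : 'I_N).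

Definition killed v : Prop := forall j j', (j < j')%N -> Ecol j j' v = 0.

(** A measure that every [Ecol j j'] with j < j' strictly lowers, so that repeated raising stops. *)
Definition colweight m : nat := (\sum_(k < N * N) m k * zcol k)%N.

Lemma colweightD m m' : colweight (m + m')%MM = (colweight m + colweight m')%N.
Proof. by rewrite -big_split; apply: eq_bigr => k _; rewrite mnmDE mulnDl. Qed.

Lemma colweightU i j : colweight U_(zidx i j) = j.
Proof.
rewrite /colweight (bigD1 (zidx i j)) //= mnm1E eqxx mul1n zcolK big1 ?addn0 //.
by move=> k; rewrite mnm1E eq_sym => /negbTE ->.
Qed.

Lemma msupp_Ecol j j' f m : (j < j')%N -> m \in msupp (Ecol j j' f) ->
  exists2 m', m' \in msupp f & (colweight m < colweight m')%N.
Proof.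
move=> jj'; rewrite mcoeff_msupp raddf_sum /= => sum_neq0.
have [i sum_i] : exists i, (z i j * dz i j' f)@_m != 0.
  apply/existsP; apply: contraNT sum_neq0; rewrite negb_exists => /forallP H.
  by rewrite big1 // => i _; apply/eqP; have := H i; rewrite negbK.
move: sum_i; rewrite mcoeff_move; case: ifPn => [_|mij]; first by rewrite eqxx.
rewrite mulrn_eq0 /= -mcoeff_msupp => fm; exists (m - U_(zidx i j) + U_(zidx i j'))%MM => //.
have -> : m = (m - U_(zidx i j) + U_(zidx i j))%MM by rewrite submK ?lep1mP.
by rewrite !colweightD !colweightU addmK ltn_add2l.
Qed.

(** Raise as long as the result is nonzero; the bound on [colweight] drops each time. The predicate
    [Q] is left open because the lemma serves both for L and for an orthogonal complement in L. *)
Lemma exists_killed (Q : A -> Prop) w :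
  (forall j j' f, (j < j')%N -> Q f -> Q (Ecol j j' f)) -> Q w -> w != 0 ->
  exists v, [/\ Q v, v != 0 & killed v].
Proof.
move=> QE Qw w0.
have [b wb] : exists b, forall m, m \in msupp w -> (colweight m < b)%N.
  exists (\sum_(m <- msupp w) colweight m).+1 => m mw.
  by rewrite ltnS (big_rem m) //= leq_addr.
elim: b w Qw w0 wb => [|b IHb] w Qw w0 wb.
  by have := wb _ (mlead_supp w0).
have [k|] := pselect (killed w); first by exists w.
move=> /existsNP[j] /existsNP[j'] /not_implyP[jj' /eqP Ew0].
apply: (IHb _ (QE _ _ _ jj' Qw) Ew0) => m /(msupp_Ecol jj')[m' m'w lt_m].
by apply: leq_trans lt_m _; rewrite -ltnS; apply: wb.
Qed.

Lemma semistd_tri m i j : semistd m -> (j < i)%N -> m (zidx i j) = 0%N.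
Proof.
move=> std_m ji.
have psum0 (p J : nat) : (p <= n)%N -> (J <= p)%N -> psum m p J = 0%N.
  elim: p J => [|p IHp] [|J] // pn Jp; try by rewrite /psum big_ord0.
  by apply/eqP; rewrite -leqn0 -(IHp J) ?(ltnW pn) // std_m // (leq_trans _ (ltnW pn)).
have := psum0 i j.+1; rewrite -ltnS ltn_ord /psum big_ord_recr /= => /(_ isT ji).
by move/eqP; rewrite addn_eq0 entE => /andP[_ /eqP].
Qed.

Definition diag_mon (lam : nat -> nat) : 'X_{1..N * N} :=
  [multinom (if zrow k == zcol k then lam (zrow k) else 0%N) | k < N * N].

Lemma diag_monE lam i j : diag_mon lam (zidx i j) = if i == j then lam i else 0%N.
Proof. by rewrite mnmE zrowK zcolK. Qed.

(* At a nonzero entry above the diagonal in the least possible row, the operator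
   moving it to the diagonal would produce a monomial that nothing cancels. *)
Lemma mlead_killed lam v : isL lam v -> v != 0 -> killed v -> mlead v = diag_mon lam.
Proof.
move=> Lv v0 kv; set mo := mlead v.
have std_mo : semistd mo by apply: isL_semistd Lv v0.
have diag_mo i j : i != j -> mo (zidx i j) = 0%N.
  have [p ip] := ubnP (i : nat); elim: p i ip j => // p IHp i; rewrite ltnS => ip j ij.
  have [lt_ij|] := ltnP i j; last first.
    rewrite leq_eqVlt => /orP[/eqP/val_inj e|ji]; first by rewrite e eqxx in ij.
    exact: semistd_tri std_mo ji.
  apply/eqP/negPn/negP => mo_ij.
  pose mo' := (mo - U_(zidx i j) + U_(zidx i i))%MM.
  have := congr1 (mcoeff mo') (kv i j lt_ij); rewrite mcoeff0 raddf_sum /=.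
  rewrite (bigD1 i) //= mcoeff_move big1 => [|p' p'i]; last first.
    rewrite mcoeff_move; have -> : mo' (zidx p' i) = 0%N; last by rewrite eqxx.
    rewrite mnmDE mnmBE !mnm1E !eq_zidx ![i == p']eq_sym (negbTE p'i) /= subn0 addn0.
    have [lt|] := ltnP p' i; first by apply: IHp => //; apply: leq_trans lt ip.
    rewrite leq_eqVlt => /orP[/eqP/val_inj e|]; first by rewrite e eqxx in p'i.
    exact: semistd_tri.
  have -> : (mo' (zidx i i) == 0%N) = false by rewrite mnmDE mnm1E eqxx addn1.
  rewrite /mo' addmK submK ?lep1mP // addr0 => /eqP.
  by rewrite mulrn_eq0 /= mleadc_eq0 (negbTE v0).
apply/mnmP => k; rewrite -(zidxK k) diag_monE; move: (zrow k) (zcol k) => i j.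
have [<-|/diag_mo//] := eqVneq i j.
rewrite -(isL_psum i Lv (mlead_supp v0)) -/mo /psum (bigD1 i) //= entE.
by rewrite big1 ?addn0 // => j' j'i; rewrite entE diag_mo // eq_sym.
Qed.

(** Subtract the multiple of [v] that cancels the coefficient at [diag_mon lam]: by [mlead_killed] a
    nonzero difference would have exactly that leading monomial. *)
Lemma killed_unique lam v w :
  isL lam v -> v != 0 -> killed v -> isL lam w -> killed w -> exists c, w = c *: v.
Proof.
move=> Lv v0 kv Lw kw; pose D := diag_mon lam.
have vD : v@_D != 0 by rewrite /D -(mlead_killed Lv v0 kv) mleadc_eq0.
exists (w@_D / v@_D); apply/eqP; rewrite -subr_eq0 -scaleNr addrC.
set u := _ + _; apply/negPn/negP => u0.
have Lu : isL lam u by apply: isL_lin.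
have ku : killed u by move=> j j' jj'; rewrite linearP /= kv // kw // scaler0 addr0.
have := mleadc_eq0 u; rewrite (mlead_killed Lu u0 ku) (negbTE u0).
by rewrite mcoeffD mcoeffZ mulNr divfK // addNr eqxx.
Qed.

End HighestWeightVectors.

Section Fischer.
Variables (F : numClosedFieldType) (K : nat).
Implicit Types (f g : {mpoly F[K]}) (m : 'X_{1..K}).

Definition mfact m : nat := (\prod_(k < K) (m k)`!)%N.

(** The weight [mfact] makes multiplication by a variable adjoint to its derivative; the conjugate
    makes the form positive definite. *)
Definition fischer f g : F :=
  \sum_(m <- msupp g) f@_m * (g@_m)^* * (mfact m)%:R.

Lemma fischer_linear g c f f' : fischer (c *: f + f') g = c * fischer f g + fischer f' g.
Proof.
rewrite /fischer mulr_sumr -big_split; apply: eq_bigr => m _ /=.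
by rewrite mcoeffD mcoeffZ !mulrDl !mulrA.
Qed.

Lemma fischer_conj f g : fischer g f = (fischer f g)^*.
Proof.
pose G m := g@_m * (f@_m)^* * (mfact m)%:R.
have -> : (fischer f g)^* = \sum_(m <- msupp g) G m.
  rewrite rmorph_sum; apply: eq_bigr => m _ /=.
  by rewrite !rmorphM /= conjCK rmorph_nat [_^* * _]mulrC.
have restr (s t : seq 'X_{1..K}) : (forall m, m \notin t -> G m = 0) ->
    \sum_(m <- s) G m = \sum_(m <- [seq m <- s | m \in t]) G m.
  move=> G0; rewrite big_filter [LHS](bigID (mem t)) /=.
  by rewrite [X in _ + X]big1 ?addr0 // => m /G0.
rewrite [LHS](restr _ (msupp g)); last first.
  by move=> m /memN_msupp_eq0 g0; rewrite /G g0 !mul0r.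
rewrite [RHS](restr _ (msupp f)); last first.
  by move=> m /memN_msupp_eq0 f0; rewrite /G f0 conjC0 mulr0 mul0r.
apply: perm_big; apply: uniq_perm; rewrite ?filter_uniq ?msupp_uniq // => m.
by rewrite !mem_filter andbC.
Qed.

Lemma fischer_sumr f (I : Type) (r : seq I) (P : pred I) (G : I -> {mpoly F[K]}) :
  fischer f (\sum_(i <- r | P i) G i) = \sum_(i <- r | P i) fischer f (G i).
Proof.
have f0 : fischer f 0 = 0 by rewrite /fischer msupp0 big_nil.
elim/big_rec2: _ => [|i y x _ <-] //.
rewrite fischer_conj -[G i]scale1r fischer_linear mul1r rmorphD /=.
by rewrite -!fischer_conj scale1r.
Qed.

Lemma fischer_suml g (I : Type) (r : seq I) (P : pred I) (G : I -> {mpoly F[K]}) :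
  fischer (\sum_(i <- r | P i) G i) g = \sum_(i <- r | P i) fischer (G i) g.
Proof.
by rewrite fischer_conj fischer_sumr rmorph_sum; apply: eq_bigr => i _; rewrite /= -fischer_conj.
Qed.

Lemma fischerZr f c g : fischer f (c *: g) = c^* * fischer f g.
Proof.
rewrite fischer_conj -[c *: g]addr0 fischer_linear rmorphD rmorphM /= -!fischer_conj.
by rewrite [X in _ + X]/fischer msupp0 big_nil addr0.
Qed.

Lemma mfactU k m : mfact (U_(k) + m) = ((m k).+1 * mfact m)%N.
Proof.
rewrite /mfact (bigD1 k) //= [in RHS](bigD1 k) //= mnmDE mnm1E eqxx add1n factS mulnA.
congr (_ * _)%N; apply: eq_bigr => k' k'k.
by rewrite mnmDE mnm1E eq_sym (negbTE k'k).
Qed.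

Lemma fischer_mderiv k f g : fischer (mderiv k f) g = fischer f (g * 'X_k).
Proof.
rewrite /fischer [RHS](perm_big _ (msuppMX _ _)) [RHS]big_map; apply: eq_bigr => m _.
rewrite mcoeffMX mfactU mcoeff_deriv natrM addmC -[f@_ _ *+ _]mulr_natl.
by rewrite [RHS]mulrCA -!mulrA.
Qed.

Lemma fischer_mulX k f g : fischer (f * 'X_k) g = fischer f (mderiv k g).
Proof. by rewrite fischer_conj -fischer_mderiv -fischer_conj. Qed.

Lemma fischer_neq0 f : f != 0 -> fischer f f != 0.
Proof.
move=> f0; rewrite /fischer psumr_neq0 => [|m _]; last first.
  by rewrite mulr_ge0 ?mul_conjC_ge0 ?ler0n.
apply/hasP; exists (mlead f); rewrite ?mlead_supp //=.
rewrite mulr_gt0 ?mul_conjC_gt0 ?mleadc_eq0 // ltr0n prodn_gt0 // => k.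
exact: fact_gt0.
Qed.

End Fischer.

(** A basis of a subspace known only as a predicate: enlarge a free family while some vector of [Q]
    lies outside its row space, which can happen at most [d] times. *)
Lemma max_row_free (F : fieldType) (d : nat) (Q : 'rV[F]_d -> Prop) :
  Q 0 -> (forall c u v, Q u -> Q v -> Q (c *: u + v)) ->
  exists r (B : 'M[F]_(r, d)),
    [/\ row_free B, forall x, Q (x *m B) & forall u, Q u -> (u <= B)%MS].
Proof.
move=> Q0 Qlin.
have step k : forall r (B : 'M[F]_(r, d)), (d - r <= k)%N -> row_free B ->
    (forall x, Q (x *m B)) -> exists r' (B' : 'M[F]_(r', d)),
    [/\ row_free B', forall x, Q (x *m B') & forall u, Q u -> (u <= B')%MS].
  elim: k => [|k IHk] r B drk freeB QB; last first.
    have [maxB|] := pselect (forall u, Q u -> (u <= B)%MS); first by exists r, B.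
    move=> /existsNP[u] /not_implyP[Qu /negP uB].
    apply: (IHk _ (col_mx u B)); [by lia| |move=> x]; last first.
      rewrite -[x]hsubmxK mul_row_col [lsubmx x]mx11_scalar mul_scalar_mx.
      exact: Qlin.
    rewrite /row_free eqn_leq rank_leq_row -addsmxE.
    have /rank_ltmx : (B < u + B)%MS.
      by rewrite /ltmx addsmxSr; apply: contra uB; apply: submx_trans; apply: addsmxSl.
    by rewrite (eqP freeB).
  exists r, B; split=> // u _; apply: submx_full; rewrite /row_full.
  rewrite eqn_leq rank_leq_col /=; move: freeB; rewrite /row_free => /eqP ->; lia.
apply: (step d 0%N 0); rewrite ?subn0 //; first by rewrite /row_free mxrank0.
by move=> x; rewrite mulmx0.
Qed.

Lemma mlead_free (R : idomainType) (K d : nat) (b : 'I_d -> {mpoly R[K]}) :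
  injective (fun t => mlead (b t)) -> (forall t, b t != 0) ->
  forall c : 'I_d -> R, \sum_t c t *: b t = 0 -> forall t, c t = 0.
Proof.
move=> inj_b b0 c sum0 t; apply/eqP/negPn/negP => ct.
have [t0 ct0 max_t0] := @Order.TotalTheory.arg_maxP _ _ _ t (fun t => c t != 0) (fun t => mlead (b t)) ct.
have := congr1 (mcoeff (mlead (b t0))) sum0.
rewrite mcoeff0 raddf_sum (bigD1 t0) //= mcoeffZ big1 ?addr0 => [|t' t't0].
  by move/eqP; rewrite mulf_eq0 mleadc_eq0 (negbTE ct0) (negbTE (b0 _)).
have [->|ct'] := eqVneq (c t') 0; first by rewrite scale0r mcoeff0.
rewrite mcoeffZ mcoeff_gt_mlead ?mulr0 // lt_neqAle.
by rewrite (inj_eq inj_b) t't0; apply: max_t0.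
Qed.

(** * The tableau basis of L and its generation by the highest weight vector *)

Section Basis.
Variables (F : numClosedFieldType) (n : nat).
Notation N := n.+1.
Notation A := {mpoly F[N * N]}.
Variables (lam : nat -> nat) (gam : seq 'X_{1..N * N}).
Hypothesis gam_uniq : uniq gam.
Hypothesis mem_gam : forall m,
  reflect (semistd m /\ forall i : 'I_N, psum m i N = lam i) (m \in gam).
Notation d := (size gam).
Implicit Types (f u v w : A).

Lemma exists_tableau_basis : exists b : 'I_d -> A, forall t,
  [/\ isL lam (b t), b t != 0, mlead (b t) = nth 0%MM gam t
    & forall m, m \in msupp (b t) -> forall j, colsum m j = colsum (nth 0%MM gam t) j].
Proof.
suff /choice[b bP] : forall t : 'I_d, exists g : A,
    [/\ isL lam g, g != 0, mlead g = nth 0%MM gam t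
      & forall m, m \in msupp g -> forall j, colsum m j = colsum (nth 0%MM gam t) j].
  by exists b.
move=> t; have /mem_gam[std_m psum_m] := mem_nth 0%MM (ltn_ord t).
have [g [Lg g0 lead_g col_g]] := exists_tableau_vector F std_m.
by exists g; split=> //; apply: eq_isL Lg => i.
Qed.

Variable b : 'I_d -> A.
Hypothesis bL : forall t, isL lam (b t).
Hypothesis b_neq0 : forall t, b t != 0.
Hypothesis mlead_b : forall t, mlead (b t) = nth 0%MM gam t.

Lemma tableau_free (c : 'I_d -> F) :
  \sum_t c t *: b t = 0 -> forall t, c t = 0.
Proof.
apply: mlead_free => // t t'; rewrite !mlead_b => /eqP.
by rewrite nth_uniq // => /eqP/val_inj.
Qed.

(** Reduction by leading terms: the leading monomial of [f] is listed in [gam], so a multiple of the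
    corresponding [b t] cancels it. *)
Lemma tableau_span f : isL lam f -> exists c : 'I_d -> F, f = \sum_t c t *: b t.
Proof.
elim/mleadrect: f => f IHf Lf; have [->|f0] := eqVneq f 0.
  by exists (fun=> 0); rewrite big1 // => t _; rewrite scale0r.
have f_gam : mlead f \in gam.
  apply/mem_gam; split; first exact: isL_semistd Lf f0.
  by move=> i; apply: isL_psum Lf (mlead_supp f0).
have tP : (index (mlead f) gam < d)%N by rewrite index_mem.
pose t := Ordinal tP; have lead_t : mlead (b t) = mlead f by rewrite mlead_b nth_index.
pose c := f@_(mlead f) / (b t)@_(mlead f).
have bt : (b t)@_(mlead f) != 0 by rewrite -lead_t mleadc_eq0.
pose f' := - c *: b t + f.
have Lf' : isL lam f' by apply: isL_lin.
have [f'0|f'0] := eqVneq f' 0.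
  exists (fun s => if s == t then c else 0).
  rewrite (bigD1 t) //= eqxx big1 => [|s /negbTE ->]; last by rewrite scale0r.
  by rewrite addr0; apply/eqP; rewrite -subr_eq0 addrC -scaleNr -f'0.
have [|c' f'E] := IHf f' _ Lf'.
  rewrite lt_neqAle; apply/andP; split.
    apply/eqP => e; move: f'0; rewrite -mleadc_eq0 e mcoeffD mcoeffZ mulNr divfK //.
    by rewrite addNr eqxx.
  apply: le_trans (mleadD_le _ _) _; rewrite leUx lexx andbT.
  by apply: le_trans (mleadZ_le _ _) _; rewrite lead_t.
exists (fun s => c' s + if s == t then c else 0).
under eq_bigr do rewrite scalerDl; rewrite big_split /= -f'E (bigD1 t) //= eqxx.
rewrite [X in _ + (_ + X)]big1 => [|s /negbTE ->]; last by rewrite scale0r.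
by rewrite addr0 /f' scaleNr addrAC addNr add0r.
Qed.

Inductive gl_generated v : A -> Prop :=
| gl_generated_zero : gl_generated v 0
| gl_generated_self : gl_generated v v
| gl_generated_E j j' f : j != j' -> gl_generated v f -> gl_generated v (Ecol j j' f)
| gl_generated_lin c f g :
    gl_generated v f -> gl_generated v g -> gl_generated v (c *: f + g).

Lemma isL_gl_generated v f : isL lam v -> gl_generated v f -> isL lam f.
Proof.
move=> Lv; elim=> // [|j j' g _ _ Lg|c g g' _ Lg _ Lg'].
- exact: isL0.
- exact: isL_E.
- exact: isL_lin.
Qed.

Lemma fischer_Ecol j j' f g : fischer (Ecol j j' f) g = fischer f (Ecol j' j g).
Proof.
rewrite fischer_suml fischer_sumr; apply: eq_bigr => i _.
by rewrite mulrC fischer_mulX fischer_mderiv mulrC.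
Qed.

(* A nonzero vector orthogonal to the submodule generated by v would produce a
   highest weight vector orthogonal to v, hence to itself. *)
Lemma fischer_perp0 v f : isL lam v -> v != 0 -> killed v -> isL lam f ->
  (forall u, gl_generated v u -> fischer f u = 0) -> f = 0.
Proof.
move=> Lv v0 kv Lf perp; apply/eqP/negPn/negP => f0.
pose Q f := isL lam f /\ forall u, gl_generated v u -> fischer f u = 0.
have [||w [[Lw perp_w] w0 kw]] := @exists_killed _ _ Q f _ _ f0.
- move=> j j' g jj' [Lg perp_g]; split; first exact: isL_E.
  move=> u gu; rewrite fischer_Ecol perp_g //; apply: gl_generated_E => //.
  by apply: contraTneq jj' => ->; rewrite ltnn.
- by split.
have [c wE] := killed_unique Lv v0 kv Lw kw.
have := perp_w w; rewrite {1}wE -[c *: v]addr0.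
move=> /(_ (gl_generated_lin _ (gl_generated_self _) (gl_generated_zero _))) /eqP.
by rewrite (negbTE (fischer_neq0 w0)).
Qed.

(* If the submodule were of smaller dimension than L, some nonzero vector of L
   would be orthogonal to it. *)
Lemma isL_is_gl_generated v f :
  isL lam v -> v != 0 -> killed v -> isL lam f -> gl_generated v f.
Proof.
move=> Lv v0 kv Lf.
pose vec (c : 'rV[F]_d) : A := \sum_t c 0 t *: b t.
have vec_lin a x y : vec (a *: x + y) = a *: vec x + vec y.
  rewrite /vec scaler_sumr -big_split; apply: eq_bigr => t _.
  by rewrite !mxE scalerDl scalerA.
have vec0 : vec 0 = 0 by rewrite /vec big1 // => t _; rewrite mxE scale0r.
have vecL c : isL lam (vec c) by apply: isL_sum => t; apply: isLZ.
have vec_surj u : isL lam u -> exists c, u = vec c.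
  move=> /tableau_span[c ->]; exists (\row_t c t).
  by apply: eq_bigr => t _; rewrite mxE.
have [||r [B [freeB QB maxB]]] := @max_row_free F d (fun c => gl_generated v (vec c)).
- by rewrite vec0; apply: gl_generated_zero.
- by move=> a x y Qx Qy; rewrite vec_lin; apply: gl_generated_lin.
have [c fE] := vec_surj f Lf.
have [rd|dr] := leqP d r.
  have /submxP[x cE] : (c <= B)%MS.
    apply: submx_full; rewrite /row_full eqn_leq rank_leq_col /=.
    by move: freeB; rewrite /row_free => /eqP ->.
  by rewrite fE cE; apply: QB.
(* With more rows than columns [G] has a nonzero left kernel vector, whose combination of the [b t]
   is orthogonal to the whole submodule. *)
pose G := \matrix_(t < d, s < r) fischer (b t) (vec (row s B)).
have : (kermx G != 0)%MS.
  rewrite -mxrank_eq0 mxrank_ker -lt0n subn_gt0.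
  exact: leq_ltn_trans (rank_leq_col _) dr.
move=> /rowV0Pn[x /sub_kermxP xG x0].
case/eqP: x0; have vx0 : vec x = 0.
  apply: (fischer_perp0 Lv v0 kv) => // u gu.
  have [y uE] := vec_surj u (isL_gl_generated Lv gu).
  have /submxP[y' yE] : (y <= B)%MS by apply: maxB; rewrite -uE.
  have {uE}-> : u = \sum_s y' 0 s *: vec (row s B).
    rewrite uE yE /vec mulmx_sum_row; under [RHS]eq_bigr do rewrite scaler_sumr.
    rewrite exchange_big; apply: eq_bigr => t _ /=.
    rewrite summxE scaler_suml; apply: eq_bigr => s _.
    by rewrite mxE scalerA.
  rewrite fischer_sumr big1 // => s _; rewrite fischerZr.
  have /rowP/(_ s) := xG; rewrite !mxE => xGs.
  rewrite fischer_suml (eq_bigr (fun t => x 0 t * G t s)); first by rewrite xGs mulr0.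
  move=> t _; rewrite mxE -[x 0 t *: b t]addr0 fischer_linear.
  by rewrite [X in _ + X]big1 ?addr0 // => m _; rewrite mcoeff0 !mul0r.
by apply/rowP => t; rewrite (tableau_free vx0) mxE.
Qed.

End Basis.

(** * Restriction to unitriangular matrices *)

Lemma big_nat0 (V : nmodType) (f : nat -> V) a b :
  (forall i, (a <= i < b)%N -> f i = 0) -> \sum_(a <= i < b) f i = 0.
Proof. by move=> f0; rewrite big_nat big1. Qed.

(* The action on the restriction y to unipotent matrices of a polynomial f on
   matrices: P p q stands for the restriction of the derivative of f with respect
   to the entry (p, q), and X p q for the entry itself. *)
Section Equivariance.
Variables (F : fieldType) (n : nat) (k : nat -> nat).
Hypothesis char0 : forall m, (m.+1%:R != 0 :> F).
Notation P := {mpoly F[nvars n]}.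
Notation N := n.+1.

(** The diagonal is -1 rather than 1 so that E_(m+1,i) comes out as minus a derivative, see
    [last_row]. *)
Definition unip (p q : nat) : P :=
  if (q < p)%N then x F n p.-1 q else if q == p then -1 else 0.

(** The part of lambda belonging to matrix row N - q, hence the weight of row q in the reversed
    numbering. *)
Definition mu (q : nat) : nat := (\sum_(N - q <= r < n) k r.+1)%N.

Variables (y : P) (Py : nat -> nat -> P).
(** The restricted row equations, solved for the derivative at (p, q) by means of [unip q q = -1].
    With [Py_eq] and [Py_lt] they express all derivatives through those of [y]. *)
Hypothesis Py_gt : forall p q, (1 <= p)%N -> (p < q)%N -> (q <= N)%N ->
  Py p q = \sum_(1 <= s < q) unip q s * Py p s.
Hypothesis Py_eq : forall p, (1 <= p <= N)%N ->
  Py p p = \sum_(1 <= s < p) unip p s * Py p s - (mu p)%:R *: y.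
Hypothesis Py_lt : forall p q, (1 <= q)%N -> (q < p)%N -> (p <= N)%N ->
  Py p q = dx p.-1 q y.

(** The column operator cut off after row m + 1. It is this truncation that realizes sl(m+1) for
    every m. *)
Definition elem (m a b : nat) : P := \sum_(1 <= p < m.+2) unip p a * Py p b.

Lemma elemS m a b : elem m.+1 a b = elem m a b + unip m.+2 a * Py m.+2 b.
Proof. by rewrite /elem big_nat_recr. Qed.

Lemma muS q : (0 < q < N)%N -> mu q.+1 = (mu q + k (N - q))%N.
Proof.
move=> /andP[q0 qN]; rewrite /mu (big_ltn (m := N - q.+1)); last lia.
by rewrite addnC; have -> : (N - q.+1).+1 = (N - q)%N by lia.
Qed.

(** Summation by parts, the increments of [mu] being the [k (N - s)]. *)
Lemma mu_sum m : (m < N)%N ->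
  (m * mu m.+1)%N = (\sum_(1 <= p < m.+1) mu p + \sum_(1 <= s < m.+1) s * k (N - s))%N.
Proof.
elim: m => [|m IHm] mN; first by rewrite !big_nil.
have := IHm (ltnW mN); rewrite !(big_nat_recr m.+1) //= (muS (_ : 0 < m.+1 < N)%N) // => e.
by rewrite mulnDr mulSn e; lia.
Qed.

(** [t] is the scalar by which the diagonal operators, normalized to have trace [c], differ from
    those of [elem], whose trace is the sum of the [mu p]. The value of [c] is exactly the one for
    which the constants in the new column add up to [- mu m.+2]. *)
Lemma cE m : (m.+1 < N)%N -> let t := m.+1%:R^-1 *
    (c F n k m.+1 - (\sum_(1 <= p < m.+2) mu p)%N%:R) in
  c F n k m.+1 + t = - (mu m.+2)%:R.
Proof.
move=> mN t; have := mu_sum mN; set T := (\sum_(1 <= s < _) s * _)%N.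
set M := (\sum_(1 <= p < _) mu p)%N => e.
have cT : c F n k m.+1 = - (m.+2%:R)^-1 * T%:R.
  rewrite /c -natr_sum; congr (_ * _%:R); rewrite big_nat_rev /T.
  rewrite -(add0n 1%N) big_addn subn1 /=; apply: eq_big_nat => i /andP[_ im].
  by congr (_ * k _)%N; lia.
have m2 := char0 m.+1; have m1 := char0 m.
have eF : m.+1%:R * (mu m.+2)%:R = M%:R + T%:R :> F by rewrite -natrM e natrD.
rewrite /t cT -/M; apply: (mulfI m1); rewrite mulrDr mulrN eF mulVKf //.
move: m2 m1; rewrite -[m.+2%:R]natr1.
move: (m.+1%:R) (M%:R) (T%:R) => u M' T' u1 _; field.
exact: u1.
Qed.

Lemma unip_gt p q : (p < q)%N -> unip p q = 0.
Proof. by move=> pq; rewrite /unip ltnNge ltnW // gtn_eqF. Qed.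

Lemma unip_eq p : unip p p = -1.
Proof. by rewrite /unip ltnn eqxx. Qed.

Lemma unip_lt p q : (q < p)%N -> unip p q = x F n p.-1 q.
Proof. by rewrite /unip => ->. Qed.

(** After exchanging the sums, row p contributes its Euler operator, which [Py_eq] evaluates. *)
Lemma elem_trace m : (m <= n)%N ->
  \sum_(1 <= t < m.+2) elem m t t = (\sum_(1 <= p < m.+2) mu p)%:R *: y.
Proof.
move=> mn; rewrite natr_sum scaler_suml /elem exchange_big.
rewrite big_nat [RHS]big_nat; apply: eq_bigr => p /andP[p1 pm] /=.
rewrite (big_cat_nat (n := p.+1)) //= [X in _ + X]big_nat0 => [|t /andP[pt _]]; last first.
  by rewrite unip_gt // mul0r.
have pN : (1 <= p <= N)%N by rewrite p1 -ltnS (leq_trans pm).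
rewrite addr0 big_nat_recr //= unip_eq (Py_eq pN).
by rewrite mulN1r opprB addrC subrK.
Qed.

Lemma gl_opE m (ops : sl_ops F n) a b : (m.+1 < N)%N ->
  (1 <= a <= m.+1)%N -> (1 <= b <= m.+1)%N ->
  (a <> b -> offd ops a b y = elem m a b) ->
  (forall t, (1 <= t <= m.+1)%N -> ddiff ops a t y = elem m a a - elem m t t) ->
  gl_op k m.+1 ops a b y = elem m a b
    + (if a == b then m.+1%:R^-1 *
         (c F n k m.+1 - (\sum_(1 <= p < m.+2) mu p)%N%:R) else 0) *: y.
Proof.
move=> mN aP bP Ho Hd; rewrite /gl_op; case: eqP => [<-|ab]; last first.
  by rewrite Ho // scale0r addr0.
rewrite (eq_big_nat _ _ (F2 := fun t => elem m a a - elem m t t)); last first.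
  by move=> t /andP[t1 tm]; apply: Hd; rewrite t1.
rewrite big_split /= sumrN elem_trace; last by rewrite ltnW.
rewrite sumr_const_nat subn1 /= addrCA scalerDr -scaler_nat scalerA mulVf // scale1r.
by rewrite -scalerBl scalerA.
Qed.

(** Row m + 2 contributes the Euler term; in the earlier rows [Py_gt] expands the derivative with
    respect to column m + 2 along the entries of row m + 2. *)
Lemma last_col m a : (m.+1 < N)%N -> (1 <= a <= m.+1)%N ->
  elem m.+1 a m.+2 = x F n m.+1 a * (euler m.+1 y - (mu m.+2)%:R *: y)
    + \sum_(1 <= r < m.+2) x F n m.+1 r * elem m a r.
Proof.
move=> mN /andP[a1 am]; rewrite elemS addrC unip_lt // Py_eq //=; congr (_ * (_ - _) + _).
  rewrite /euler; apply: eq_big_nat => s /andP[s1 sm].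
  by rewrite unip_lt // Py_lt.
rewrite /elem; under [RHS]eq_bigr do rewrite mulr_sumr.
rewrite exchange_big; apply: eq_big_nat => p /andP[p1 pm].
rewrite Py_gt // mulr_sumr; apply: eq_big_nat => s /andP[s1 sm].
by rewrite (unip_lt sm) mulrCA.
Qed.

Lemma last_row m b : (m.+1 <= N)%N -> (1 <= b <= m)%N ->
  elem m m.+1 b = - dx m b y.
Proof.
move=> mN /andP[b1 bm]; rewrite /elem big_nat_recr //= unip_eq mulN1r Py_lt //.
by rewrite big_nat0 ?add0r // => p /andP[_ pm]; rewrite unip_gt // mul0r.
Qed.

Lemma last_diag m : (m.+1 < N)%N -> elem m.+1 m.+2 m.+2 = (mu m.+2)%:R *: y - euler m.+1 y.
Proof.
move=> mN; rewrite elemS unip_eq Py_eq // mulN1r opprB.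
rewrite /elem big_nat0 ?add0r => [|p /andP[_ pm]]; last by rewrite unip_gt // mul0r.
congr (_ - _); apply: eq_big_nat => s /andP[s1 sm].
by rewrite unip_lt // Py_lt.
Qed.

(** Induction on m: the summand that [elemS] adds, rewritten by the row equations, is what
    [step_offd] and [step_ddiff] add. The scalar discrepancy of [gl_op] is absorbed by [cE]. *)
Lemma action_restr m : (1 <= m <= n)%N -> forall a b,
  (1 <= a <= m.+1)%N -> (1 <= b <= m.+1)%N ->
  (a <> b -> offd (sl_action F n k m) a b y = elem m a b)
  /\ ddiff (sl_action F n k m) a b y = elem m a a - elem m b b.
Proof.
elim: m => [//|m IHm] mn a b aP bP.
have [m0|m_gt0] := posnP m.
  move: aP bP mn; rewrite {}m0 => aP bP /= mn.
  have Py11 : Py 1 1 = 0.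
    by rewrite Py_eq // big_nil sub0r /mu subn1 /= big_geq // scale0r oppr0.
  have Py12 : Py 1 2 = 0 by rewrite Py_gt // big_nat1 Py11 mulr0.
  have Py21 : Py 2 1 = dx 1 1 y by rewrite Py_lt.
  have Py22 : Py 2 2 = x F n 1 1 * dx 1 1 y - (k n)%:R *: y.
    rewrite Py_eq // big_nat1 Py21 unip_lt //; congr (_ - _%:R *: _).
    by rewrite muS // subn1 /mu subn1 /= big_geq.
  have elem1 a' b' : elem 1 a' b' = unip 1 a' * Py 1 b' + unip 2 a' * Py 2 b'.
    by rewrite /elem big_nat_recr // big_nat1.
  have u12 : unip 1 2 = 0 by [].
  have u21 : unip 2 1 = x F n 1 1 by [].
  have a12 : a = 1%N \/ a = 2 by lia.
  have b12 : b = 1%N \/ b = 2 by lia.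
  case: a12 => ->; case: b12 => -> /=; split=> //; rewrite !elem1 ?unip_eq ?u12 ?u21
    ?Py11 ?Py12 ?Py21 ?Py22 ?subrr // ?mulr0 ?mul0r ?add0r ?mulN1r //.
  - by rewrite mulrBr mulrA -expr2 scalerAr.
  - by rewrite scaler_nat mulr2n opprK addrA.
  - by rewrite scaler_nat mulr2n -opprD addrAC.
have {IHm}IH := IHm _; rewrite m_gt0 ltnW // in IH; have {}IH := IH isT.
have mN : (m.+1 < N)%N by [].
have glE a' b' : (1 <= a' <= m.+1)%N -> (1 <= b' <= m.+1)%N -> 
  gl_op k m.+1 (sl_action F n k m) a' b' y = elem m a' b'
    + (if a' == b' then m.+1%:R^-1 *
         (c F n k m.+1 - (\sum_(1 <= p < m.+2) mu p)%N%:R) else 0) *: y.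
  move=> a'P b'P; apply: gl_opE => //; first by apply IH.
  by move=> t tP; apply IH.
have ct := cE mN; rewrite /= in ct; set t := m.+1%:R^-1 * _ in glE ct.
have muy : (mu m.+2)%:R *: y = - (c F n k m.+1 *: y + t *: y).
  by rewrite -scalerDl ct scaleNr opprK.
have -> : sl_action F n k m.+1 = SlOps (step_offd k m.+1 (sl_action F n k m))
    (step_ddiff k m.+1 (sl_action F n k m)).
  by case: (m) m_gt0.
have lowE a' b' : (1 <= a' <= m.+1)%N -> (1 <= b' <= m.+1)%N ->
    step_low m.+1 (sl_action F n k m) a' b' y = elem m.+1 a' a' - elem m.+1 b' b'.
  move=> a'P b'P; have [_] := IH _ _ a'P b'P; rewrite /step_low => ->.
  have [/andP[a'1 a'm] /andP[b'1 b'm]] := (a'P, b'P).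
  rewrite !elemS (unip_lt (a'm : a' < m.+2)%N) (unip_lt (b'm : b' < m.+2)%N) !Py_lt //=.
  by ring.
have lastE : step_last k m.+1 (sl_action F n k m) y
    = elem m.+1 m.+1 m.+1 - elem m.+1 m.+2 m.+2.
  rewrite /step_last glE ?leqnn // eqxx last_diag // opprB elemS unip_lt // Py_lt //=.
  by rewrite muy; ring.
have outP p : (1 <= p <= m.+2)%N -> p != m.+2 -> (1 <= p <= m.+1)%N.
  by move=> /andP[-> pm] pn /=; rewrite -ltnS ltn_neqAle pn.
split=> [ab|] /=.
  rewrite /step_offd; have [bm|bm] := eqVneq b m.+2.
    have am : (1 <= a <= m.+1)%N by apply: outP => //; apply/eqP => am; rewrite am bm in ab.
    rewrite bm last_col //.
    rewrite (eq_big_nat _ _ (F2 := fun r => x F n m.+1 r * elem m a r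
      + if r == a then x F n m.+1 r * (t *: y) else 0)); last first.
      move=> r /andP[r1 rm]; rewrite glE //; last by rewrite r1.
      rewrite mulrDr [a == r]eq_sym; case: ifP => //.
      by rewrite scale0r mulr0.
    rewrite big_split /= -big_mkcond /= big_nat1_eq am muy scalerAr; ring.
  have bP' := outP _ bP bm; have [am|am] := eqVneq a m.+2.
    by rewrite am last_row.
  have aP' := outP _ aP am; have [IHo _] := IH _ _ aP' bP'.
  rewrite IHo // elemS unip_lt ?Py_lt //=; try by lia.
  by rewrite addrC.
rewrite /step_ddiff; have [am|am] := eqVneq a m.+2; have [bm|bm] := eqVneq b m.+2 => /=.
- by rewrite am bm subrr.
- by rewrite lowE ?lastE ?leqnn ?outP // am subrKA opprB.
- by rewrite lowE ?lastE ?leqnn ?outP // bm subrKA.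
- by rewrite lowE ?outP.
Qed.

End Equivariance.

Lemma mpoly_alg_ind (R : comNzRingType) (K : nat) (Q : {mpoly R[K]} -> Prop) :
  (forall c f g, Q f -> Q g -> Q (c *: f + g)) -> Q 1 -> (forall l, Q 'X_l) ->
  (forall f g, Q f -> Q g -> Q (f * g)) -> forall f, Q f.
Proof.
move=> Qlin Q1 QX QM; have Q0 : Q 0 by rewrite -(subrr 1) -scaleN1r addrC; apply: Qlin.
elim/mpolyind => // c m p _ _ Qp; apply: Qlin => //.
rewrite mpolyXE_id; elim/big_ind: _ => // l _.
by elim: (m l) => [|e IHe]; rewrite ?expr0 // exprS; apply: QM.
Qed.

(** * Numbering of the variables x_(i,j) *)

Section VariableIndex.
Variable n : nat.

Lemma bin2_mono i i' : (i <= i')%N -> ('C(i, 2) <= 'C(i', 2))%N.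
Proof. by move=> ii'; rewrite leq_bin2l. Qed.

Lemma bin2S i : 'C(i.+1, 2) = ('C(i, 2) + i)%N.
Proof. by rewrite binS bin1. Qed.

Lemma nvars_gt i j : (1 <= j <= i)%N -> (i <= n)%N -> ('C(i, 2) + j.-1 < nvars n)%N.
Proof.
move=> /andP[j1 ji] i_n; have := bin2_mono (i_n : i < n.+1)%N.
by rewrite /nvars bin2S; lia.
Qed.

Lemma xidx_inj i j i' j' : (1 <= j <= i)%N -> (i <= n)%N ->
  (1 <= j' <= i')%N -> (i' <= n)%N -> xidx n i j = xidx n i' j' -> i = i' /\ j = j'.
Proof.
move=> ji i_n ji' i'n /(congr1 val); rewrite /= !inordK ?nvars_gt // => e.
have ii' : i = i'.
  have [lt|gt|//] := ltngtP i i'; [have := bin2_mono lt|have := bin2_mono gt];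
    rewrite bin2S; lia.
by split=> //; rewrite ii' in e *; lia.
Qed.

Lemma xidx_surj (hn : (0 < n)%N) (v : 'I_(nvars n)) :
  exists i j, [/\ (1 <= j <= i)%N, (i <= n)%N & v = xidx n i j].
Proof.
have vn : (v < 'C(n.+1, 2))%N.
  have := ltn_ord v; rewrite /nvars => vn; apply: leq_trans vn _.
  by rewrite prednK // bin_gt0; lia.
have decomp (u : nat) : (u < 'C(n.+1, 2))%N ->
    exists i j, [/\ (1 <= j <= i)%N, (i <= n)%N & u = ('C(i, 2) + j.-1)%N].
  elim: (n) => [|p IHp]; first by rewrite bin_small.
  have [/IHp[i [j [ji ip e]]] _|ge] := ltnP u 'C(p.+1, 2).
    by exists i, j; split=> //; apply: leqW.
  rewrite bin2S => lt; exists p.+1, (u - 'C(p.+1, 2)).+1; split; lia.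
have [i [j [ji i_n e]]] := decomp _ vn; exists i, j; split=> //.
by apply: val_inj; rewrite /= inordK ?nvars_gt.
Qed.

End VariableIndex.

(** * The restriction map and the given action *)

Section Restriction.
Variables (F : numClosedFieldType) (n : nat) (k : nat -> nat).
Notation N := n.+1.
Notation A := {mpoly F[N * N]}.
Notation P := {mpoly F[nvars n]}.
Notation z i j := ('X_(zidx i j) : A).
Notation dz i j := (mderiv (zidx i j)).
Implicit Types (f g v w : A) (m : 'X_{1..N * N}) (i j : 'I_N).

Lemma dx_x p q a b : (1 <= q <= p)%N -> (p <= n)%N -> (1 <= b <= a)%N -> (a <= n)%N ->
  dx a b (x F n p q) = ((p == a) && (q == b))%:R.
Proof.
move=> qp pn ba an; rewrite /dx /x mderivU; congr (nat_of_bool _)%:R.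
by apply/eqP/andP => [/(xidx_inj qp pn ba an)[-> ->]|[/eqP-> /eqP->]].
Qed.

Definition zval (i : 'I_(N * N)) : P := unip F n (N - zrow i) (N - zcol i).

(* Restriction to lower unitriangular matrices, up to sign conventions: the entry
   (i, j) of a matrix is the entry (N - i, N - j) of the paper. *)
Definition restr f : P := mmap (@mpolyC (nvars n) F) zval f.

Lemma restr_lin c f g : restr (c *: f + g) = c *: restr f + restr g.
Proof. by rewrite /restr raddfD /= mmapZ mul_mpolyC. Qed.

Lemma restr0 : restr 0 = 0. Proof. exact: raddf0. Qed.

Lemma restrD f g : restr (f + g) = restr f + restr g.
Proof. exact: raddfD. Qed.

Lemma restrZ c f : restr (c *: f) = c *: restr f.
Proof. by rewrite -[c *: f]addr0 restr_lin restr0 addr0. Qed.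

Lemma restr_sum (I : Type) (r : seq I) (Q : pred I) (G : I -> A) :
  restr (\sum_(i <- r | Q i) G i) = \sum_(i <- r | Q i) restr (G i).
Proof. exact: raddf_sum. Qed.

Lemma restrM f g : restr (f * g) = restr f * restr g.
Proof. exact: rmorphM. Qed.

Lemma restr_U l : restr 'X_l = zval l.
Proof. by rewrite /restr mmapX mmap1U. Qed.

Lemma restr1 : restr 1 = 1.
Proof. exact: rmorph1. Qed.

Lemma dx_unip p q a b : (1 <= b <= a)%N -> (a <= n)%N -> (1 <= q)%N -> (p <= N)%N ->
  dx a b (unip F n p q) = ((p == a.+1) && (q == b))%:R.
Proof.
move=> ba an q1 pN; rewrite /unip; have [qp|pq|<-] := ltngtP q p.
- by case: p pN qp => // p pN qp; rewrite dx_x //; lia.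
- rewrite /dx mderiv0; have -> // : (p == a.+1) && (q == b) = false by apply/negP; lia.
- rewrite /dx mderivN -mpolyC1 mderivC oppr0.
  by have -> : (q == a.+1) && (q == b) = false by apply/negP; lia.
Qed.

(** Restriction substitutes distinct variables for the entries above the diagonal and constants for
    all others, so it commutes with the derivatives in those entries. *)
Lemma restr_dz i j f : (i < j)%N -> restr (dz i j f) = dx (n - i) (N - j) (restr f).
Proof.
move=> ij; elim/mpoly_alg_ind: f => [c f g IHf IHg||l|f g IHf IHg].
- by rewrite linearP /= !restr_lin IHf IHg /dx linearP.
- by rewrite -mpolyC1 mderivC restr0 mpolyC1 restr1 /dx -mpolyC1 mderivC.
- rewrite mderivU restr_U /zval dx_unip; try by have := ltn_ord j; have := ltn_ord (zcol l); lia.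
  rewrite -{1}(zidxK l) eq_zidx; set b := _ && _; set b' := _ && _.
  have -> : b' = b.
    rewrite /b /b' -!val_eqE /=; have := ltn_ord j; have := ltn_ord i.
    by have := ltn_ord (zcol l); have := ltn_ord (zrow l); lia.
  by case: b; rewrite ?restr1 ?restr0.
- by rewrite mderivM restrD !restrM IHf IHg /dx mderivM.
Qed.

Lemma sum_rev_ord (V : nmodType) (G : 'I_N -> V) :
  \sum_j G j = \sum_(1 <= q < N.+1) G (inord (N - q)).
Proof.
rewrite big_add1 /= big_mkord (reindex_inj rev_ord_inj) /=.
by apply: eq_bigr => q _; congr G; apply: val_inj; rewrite /= inordK //; lia.
Qed.

Definition lamk (i : nat) : nat := (\sum_(i <= r < n) k r.+1)%N.
Definition Pz f (p q : nat) : P := restr (dz (inord (N - p)) (inord (N - q)) f).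

Lemma restr_z p q : (1 <= p <= N)%N -> (1 <= q <= N)%N ->
  restr (z (inord (N - p)) (inord (N - q))) = unip F n p q.
Proof.
move=> pN qN; rewrite restr_U /zval zrowK zcolK !inordK; try by lia.
by congr unip; lia.
Qed.

Lemma restr_Drow f p q : (1 <= p <= N)%N -> (1 <= q <= N)%N ->
  restr (Drow (inord (N - q)) (inord (N - p)) f)
  = \sum_(1 <= s < q) unip F n q s * Pz f p s - Pz f p q.
Proof.
move=> pN qN; rewrite restr_sum sum_rev_ord (big_cat_nat (n := q.+1)) //=; try by lia.
rewrite [X in _ + X]big_nat0 ?addr0 => [|s /andP[qs sN]]; last first.
  by rewrite restrM restr_z ?unip_gt ?mul0r //; lia.
rewrite big_nat_recr /=; last by lia.
rewrite restrM restr_z // unip_eq mulN1r; congr (_ - _).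
apply: eq_big_nat => s /andP[s1 sq].
by rewrite restrM restr_z //; lia.
Qed.

Section RestrictionOfL.
Variable f : A.
Hypothesis Lf : isL lamk f.

Lemma Pz_gt p q : (1 <= p)%N -> (p < q)%N -> (q <= N)%N ->
  Pz f p q = \sum_(1 <= s < q) unip F n q s * Pz f p s.
Proof.
move=> p1 pq qN; apply/eqP; rewrite eq_sym -subr_eq0 -restr_Drow; try by lia.
rewrite Lf; last by rewrite !inordK; lia.
have -> : (inord (N - q) == inord (N - p) :> 'I_N) = false.
  by apply/eqP => /(congr1 val); rewrite /= !inordK; lia.
by rewrite scale0r restr0.
Qed.

Lemma Pz_eq p : (1 <= p <= N)%N ->
  Pz f p p = \sum_(1 <= s < p) unip F n p s * Pz f p s - (mu n k p)%:R *: restr f.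
Proof.
move=> pN; have := restr_Drow f pN pN; rewrite Lf // eqxx restrZ inordK; last by lia.
by rewrite -/(mu n k p) => ->; rewrite opprB addrC subrK.
Qed.

Lemma Pz_lt p q : (1 <= q)%N -> (q < p)%N -> (p <= N)%N ->
  Pz f p q = dx p.-1 q (restr f).
Proof.
move=> q1 qp pN; rewrite /Pz restr_dz; last by rewrite !inordK; lia.
rewrite !inordK; try by lia.
have -> : (n - (N - p))%N = p.-1 by lia.
by have -> : (N - (N - q))%N = q by lia.
Qed.

Let char0 (m : nat) : m.+1%:R != 0 :> F.
Proof. by rewrite pnatr_eq0. Qed.

Notation elemf := (elem (Pz f)).

Lemma offd_restr (m a b : nat) : (1 <= m <= n)%N -> (1 <= a <= m.+1)%N -> (1 <= b <= m.+1)%N ->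
  a <> b -> offd (sl_action F n k m) a b (restr f) = elemf m a b.
Proof. by move=> mn aP bP; apply: (action_restr char0 Pz_gt Pz_eq Pz_lt mn aP bP).1. Qed.

Lemma ddiff_restr (m a b : nat) : (1 <= m <= n)%N -> (1 <= a <= m.+1)%N -> (1 <= b <= m.+1)%N ->
  ddiff (sl_action F n k m) a b (restr f) = elemf m a a - elemf m b b.
Proof. by move=> mn aP bP; apply: (action_restr char0 Pz_gt Pz_eq Pz_lt mn aP bP).2. Qed.

Lemma restr_Ecol a b : (1 <= a <= N)%N -> (1 <= b <= N)%N ->
  restr (Ecol (inord (N - a)) (inord (N - b)) f) = elemf n a b.
Proof.
move=> aN bN; rewrite restr_sum sum_rev_ord; apply: eq_big_nat => p pN.
by rewrite restrM restr_z.
Qed.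

(* The operators of sl(m+1) preserve the polynomials in the first m rows. *)
Lemma dx_Pz (m a b : nat) : (m < a)%N -> (1 <= b <= a)%N -> (a <= n)%N ->
  dx a b (restr f) = 0 -> forall p s, (1 <= p <= m.+1)%N -> (1 <= s <= m.+1)%N ->
  dx a b (Pz f p s) = 0.
Proof.
(* On and above the diagonal of the reversed numbering [Pz] is expressed through smaller column
   indices, hence the induction on [s]; below it, [Pz] is a derivative of [restr f]. *)
move=> ma ba an dxf p s pm; have [d] := ubnP s; elim: d s => // d IHd s.
rewrite ltnS => sd sm.
have sumE : dx a b (\sum_(1 <= t < s) unip F n s t * Pz f p t) = 0.
  rewrite /dx raddf_sum /=; apply: big_nat0 => t ts.
  have t0 : mderiv (xidx n a b) (Pz f p t) = 0 by apply: IHd; lia.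
  rewrite mderivM t0 mulr0 addr0.
  have := @dx_unip s t a b; rewrite /dx => ->; try by lia.
  by have -> : (s == a.+1) = false by [lia]; rewrite mul0r.
have [sp|ps|ps] := ltngtP s p.
- rewrite Pz_lt; try by lia.
  by rewrite /dx mderiv_comm -!/(dx _ _ _) dxf /dx mderiv0.
- by rewrite Pz_gt //; lia.
- rewrite ps in sumE *; rewrite Pz_eq; last by lia.
  by rewrite /dx mderivB mderivZ -!/(dx _ _ _) sumE dxf scaler0 subr0.
Qed.

Lemma dx_elem (m a b c d : nat) : (m < a)%N -> (1 <= b <= a)%N -> (a <= n)%N ->
  dx a b (restr f) = 0 -> (1 <= c <= m.+1)%N -> (1 <= d <= m.+1)%N ->
  dx a b (elemf m c d) = 0.
Proof.
move=> ma ba an dxf cm dm; rewrite /dx raddf_sum /=; apply: big_nat0 => p pm.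
have t0 : mderiv (xidx n a b) (Pz f p d) = 0 by apply: (dx_Pz ma) => //; lia.
rewrite mderivM t0 mulr0 addr0.
have := @dx_unip p c a b; rewrite /dx => ->; try by lia.
by have -> : (p == a.+1) = false by [lia]; rewrite mul0r.
Qed.

(** The rows beyond m + 1 only contribute derivatives in variables that [restr f] does not
    contain. *)
Lemma elem_full (m c d : nat) : (m <= n)%N ->
  (forall a b, (m < a <= n)%N -> (1 <= b <= a)%N -> dx a b (restr f) = 0) ->
  (1 <= d <= m.+1)%N -> elemf n c d = elemf m c d.
Proof.
move=> mn dxf dm; rewrite /elem (big_cat_nat (n := m.+2)) //=.
rewrite [X in _ + X]big_nat0 ?addr0 // => p pn.
rewrite Pz_lt; try by lia.
by rewrite dxf ?mulr0 //; lia.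
Qed.

End RestrictionOfL.

(** E_(p+1,q) acts on the restriction as minus the derivative in x_(p,q) plus multiples of
    derivatives in later rows; descending induction on p removes the latter. So the highest weight
    vector restricts to a constant. *)
Lemma restr_killed v : isL lamk v -> killed v ->
  forall p q, (1 <= q <= p)%N -> (p <= n)%N -> dx p q (restr v) = 0.
Proof.
move=> Lv kv p q; have [d] := ubnP (n - p); elim: d p q => // d IHd p q pd qp pn.
have e : 0 = elem (Pz v) n p.+1 q.
  rewrite -restr_Ecol; try by lia.
  by rewrite kv ?restr0 // !inordK; lia.
have low : \sum_(1 <= r < p.+1) unip F n r p.+1 * Pz v r q = 0.
  by apply: big_nat0 => r rp; rewrite unip_gt ?mul0r //; lia.
have high : \sum_(p.+2 <= r < N.+1) unip F n r p.+1 * Pz v r q = 0.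
  apply: big_nat0 => r rp; rewrite Pz_lt; try by lia.
  by rewrite IHd ?mulr0 //; lia.
move: e; rewrite /elem (big_cat_nat (n := p.+1)) //=; try by lia.
rewrite low add0r big_ltn; last by lia.
rewrite high addr0 unip_eq mulN1r Pz_lt //=; try by lia.
by move/eqP; rewrite eq_sym oppr_eq0 => /eqP.
Qed.

End Restriction.

Lemma mderiv_eq0 (R : numDomainType) (K : nat) (f : {mpoly R[K]}) :
  (forall l, mderiv l f = 0) -> f = (f@_0%MM)%:MP.
Proof.
move=> df0; apply/mpolyP => m; rewrite mcoeffC.
have [->|/eqP m0] := eqVneq m 0%MM; first by rewrite mulr1.
have [l ml] : exists l, m l != 0%N.
  apply/existsP; apply: contra_notT m0; rewrite negb_exists => /forallP ml.
  by apply/mnmP => l; rewrite mnm0E; apply/eqP; have := ml l; rewrite negbK.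
have := congr1 (mcoeff (m - U_(l))%MM) (df0 l).
rewrite mcoeff_deriv submK ?lep1mP // mcoeff0 mulr0 => /eqP.
by rewrite mulrn_eq0 /= => /eqP.
Qed.

(** * Injectivity of the restriction on L *)

Section RestrictionInjective.
Variables (F : numClosedFieldType) (n : nat) (k : nat -> nat).
Notation N := n.+1.
Notation A := {mpoly F[N * N]}.
Notation P := {mpoly F[nvars n]}.
Implicit Types (f g v w : A) (m : 'X_{1..N * N}) (i j : 'I_N).

Definition upper m : bool := [forall i : 'I_N, forall j : 'I_N, (j < i)%N ==> (m (zidx i j) == 0%N)].

(** The exponent of the restricted monomial: the diagonal exponents are lost and leave only the sign
    [diag_sign]. *)
Definition above m : 'X_{1..nvars n} :=
  (\sum_(l < N * N | (zrow l < zcol l)%N) U_(xidx n (n - zrow l) (N - zcol l)) *+ m l)%MM.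

Definition diag_sign m : F := \prod_(l < N * N | zrow l == zcol l) (-1) ^+ m l.

Lemma diag_sign_neq0 m : diag_sign m != 0.
Proof. by apply/prodf_neq0 => l _; rewrite signr_eq0. Qed.

Lemma mmap1_zval m :
  mmap1 (@zval F n) m = if upper m then diag_sign m *: 'X_[above m] else 0.
Proof.
case: ifPn => [/forallP up|].
  rewrite /mmap1 (bigID (fun l : 'I_(N * N) => zrow l < zcol l)%N) /=.
  rewrite mulrC -mul_mpolyC /above -mprodXnE; congr (_ * _); last first.
    apply: eq_bigr => l lt_l; have lN := ltn_ord (zcol l).
    by rewrite /zval unip_lt /x; [have -> : (N - zrow l).-1 = (n - zrow l)%N by lia | lia].
  rewrite (bigID (fun l => zrow l == zcol l)) /= [X in _ * X]big1 ?mulr1.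
    rewrite rmorph_prod /=; apply: eq_big => [l|l /andP[_ /eqP e]].
      by case: eqP => [->|_]; rewrite ?ltnn ?andbF.
    by rewrite /zval e unip_eq rmorphXn /= rmorphN1.
  move=> l /andP[nlt ne]; have := up (zrow l) => /forallP/(_ (zcol l)).
  by rewrite zidxK -!val_eqE /= in ne *; rewrite ltn_neqAle eq_sym ne leqNgt nlt /= => /eqP ->.
move=> /forallPn[i /forallPn[j]].
rewrite negb_imply => /andP[ji mij]; rewrite /mmap1 (bigD1 (zidx i j)) //=.
rewrite /zval zrowK zcolK unip_gt; last by have := ltn_ord i; lia.
by rewrite expr0n (negbTE mij) mul0r.
Qed.

Lemma aboveE m i j : (i < j)%N -> above m (xidx n (n - i) (N - j)) = m (zidx i j).
Proof.
move=> ij; rewrite /above mnm_sumE (bigD1 (zidx i j)) ?zrowK ?zcolK //=.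
rewrite mulmnE mnm1E eqxx mul1n big1 ?addn0 // => l /andP[lt_l ne_l].
rewrite mulmnE mnm1E; case: eqP => // /xidx_inj.
have := ltn_ord j; have := ltn_ord (zcol l) => lN jN [||||e1 e2]; try by lia.
case/eqP: ne_l; rewrite -(zidxK l); congr zidx; apply: val_inj => /=; lia.
Qed.

(** The lost diagonal exponents are recovered from the row sums, which [isL] prescribes. *)
Lemma above_inj lam f m m' : isL lam f -> m \in msupp f -> m' \in msupp f ->
  upper m -> upper m' -> above m = above m' -> m = m'.
Proof.
move=> Lf mf m'f /forallP um /forallP um' e.
have off i j : i != j -> m (zidx i j) = m' (zidx i j).
  move=> ij; have [lt|] := ltnP i j; first by rewrite -!aboveE // e.
  rewrite leq_eqVlt => /orP[/eqP/val_inj ji|lt]; first by rewrite ji eqxx in ij.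
  have /forallP/(_ j) := um i; have /forallP/(_ j) := um' i.
  by rewrite lt => /eqP -> /eqP ->.
apply/mnmP => l; rewrite -(zidxK l); move: (zrow l) (zcol l) => i j.
have [<-|/off//] := eqVneq i j.
have := isL_psum i Lf mf; rewrite -(isL_psum i Lf m'f) /psum.
rewrite (bigD1 i) //= [in RHS](bigD1 i) //= !entE.
rewrite (eq_bigr (fun j : 'I_N => ent m' i j)); first by lia.
by move=> j' j'i; rewrite !entE off // eq_sym.
Qed.

(** The leading monomial is semistandard, hence upper triangular, so it survives restriction; by
    [above_inj] no other monomial of [f] can cancel it. *)
Lemma restr_eq0 lam f : isL lam f -> restr f = 0 -> f = 0.
Proof.
move=> Lf rf; apply/eqP/negPn/negP => f0; set mo := mlead f.
have mof : mo \in msupp f by apply: mlead_supp.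
have up_mo : upper mo.
  apply/forallP => i; apply/forallP => j; apply/implyP => ji; apply/eqP.
  by apply: semistd_tri ji; apply: isL_semistd Lf f0.
have := congr1 (mcoeff (above mo)) rf; rewrite mcoeff0 /restr /mmap raddf_sum /=.
rewrite (bigD1_seq mo) ?msupp_uniq //= mmap1_zval up_mo mul_mpolyC !mcoeffZ mcoeffX eqxx mulr1.
rewrite big_seq_cond big1 ?addr0 => [/eqP|m /andP[mf m_mo]].
  by rewrite mulf_eq0 mleadc_eq0 (negbTE f0) (negbTE (diag_sign_neq0 _)).
rewrite mmap1_zval; case: ifP => [um|_]; last by rewrite mulr0 mcoeff0.
rewrite mul_mpolyC !mcoeffZ mcoeffX; case: eqP => [e|_]; last by rewrite !mulr0.
by case/eqP: m_mo; apply: above_inj Lf mf mof um up_mo e.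
Qed.

Lemma restr_killed_const v : (0 < n)%N -> isL (lamk n k) v -> v != 0 -> killed v ->
  exists2 a : F, a != 0 & restr v = a%:MP.
Proof.
move=> n_gt0 Lv v0 kv; have rv : restr v = ((restr v)@_0%MM)%:MP.
  apply: mderiv_eq0 => l; have [p [q [qp pn ->]]] := xidx_surj n_gt0 l.
  exact: restr_killed Lv kv _ _ qp pn.
exists (restr v)@_0%MM => //; apply: contra_neq v0 => r0.
by apply: restr_eq0 Lv _; rewrite rv r0 mpolyC0.
Qed.

End RestrictionInjective.

(** * The modules V^(m) *)

Section LinearAction.
Variables (F : fieldType) (n : nat) (k : nat -> nat).
Notation P := {mpoly F[nvars n]}.

Definition linear_op (T : P -> P) : Prop :=
  forall a p q, T (a *: p + q) = a *: T p + T q.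

Lemma linear_op_dx i j : linear_op (@dx F n i j).
Proof. by move=> a p q; rewrite /dx linearP. Qed.

Lemma linear_op_mul u T : linear_op T -> linear_op (fun p => u * T p).
Proof. by move=> lT a p q; rewrite lT mulrDr -scalerAr. Qed.

Lemma linear_op_id : linear_op id. Proof. by []. Qed.

Lemma linear_op_scale b T : linear_op T -> linear_op (fun p => b *: T p).
Proof. by move=> lT a p q; rewrite lT scalerDr !scalerA mulrC. Qed.

Lemma linear_op_add T U : linear_op T -> linear_op U -> linear_op (fun p => T p + U p).
Proof. by move=> lT lU a p q; rewrite lT lU scalerDr addrACA. Qed.

Lemma linear_op_opp T : linear_op T -> linear_op (fun p => - T p).
Proof. by move=> lT a p q; rewrite lT opprD scalerN. Qed.

Lemma linear_op_zero : linear_op (fun=> 0).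
Proof. by move=> a p q; rewrite scaler0 addr0. Qed.

Lemma linear_op_sum (I : Type) (r : seq I) (T : I -> P -> P) :
  (forall i, linear_op (T i)) -> linear_op (fun p => \sum_(i <- r) T i p).
Proof.
move=> lT a p q; rewrite scaler_sumr -big_split; apply: eq_bigr => i _; exact: lT.
Qed.

Lemma linear_op_euler m : linear_op (@euler F n m).
Proof. by apply: linear_op_sum => s; apply/linear_op_mul/linear_op_dx. Qed.

Lemma linear_op_gl m (ops : sl_ops F n) i j :
  (forall i j, linear_op (offd ops i j)) -> (forall i j, linear_op (ddiff ops i j)) ->
  linear_op (gl_op k m ops i j).
Proof.
move=> lo ld; rewrite /gl_op; case: (_ == _); last exact: lo.
apply: linear_op_scale; apply: linear_op_add; last exact: linear_op_sum.
exact/linear_op_scale/linear_op_id.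
Qed.

Lemma linear_op_sl_action m :
  (forall i j, linear_op (offd (sl_action F n k m) i j)) /\
  (forall i j, linear_op (ddiff (sl_action F n k m) i j)).
Proof.
have lx u i j : linear_op (fun p : P => u * dx i j p) by apply/linear_op_mul/linear_op_dx.
have lk (b : F) u : linear_op (fun p : P => b *: (u * p)).
  exact/linear_op_scale/linear_op_mul/linear_op_id.
have ls (b : F) : linear_op (fun p : P => b *: p) by apply/linear_op_scale/linear_op_id.
elim: m => [|m [lo ld]]; first by split=> i j; apply: linear_op_zero.
case: m lo ld => [|m] lo ld; split=> i j /=.
- case: (_ && _); first by apply: linear_op_add; [|apply: linear_op_opp].
  by case: (_ && _); [apply/linear_op_opp/linear_op_dx | apply: linear_op_zero].
- have lh : linear_op (fun p : P => 2%:R *: (x F n 1 1 * dx 1 1 p) - (k n)%:R *: p).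
    by apply: linear_op_add; [apply/linear_op_scale | apply/linear_op_opp].
  case: (_ && _) => //.
  by case: (_ && _); [apply: linear_op_opp | apply: linear_op_zero].
- rewrite /step_offd; case: (_ == _).
    apply: linear_op_add; last first.
      by apply: linear_op_sum => r; apply/linear_op_mul/linear_op_gl.
    by apply: linear_op_add => //; apply/linear_op_mul/linear_op_euler.
  by case: (_ == _); [apply/linear_op_opp/linear_op_dx | apply: linear_op_add].
- have low a b : linear_op (step_low m.+2 (sl_action F n k m.+1) a b).
    by apply: linear_op_add => //; apply: linear_op_add => //; apply: linear_op_opp.
  have last : linear_op (step_last k m.+2 (sl_action F n k m.+1)).
    apply: linear_op_add; last exact: linear_op_gl.
    by apply: linear_op_add => //; apply: linear_op_add => //; apply: linear_op_euler.
  rewrite /step_ddiff; case: (_ && _); first exact: linear_op_zero.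
  case: (_ == _); first exact: linear_op_add.
  by case: (_ == _) => //; apply/linear_op_opp/linear_op_add.
Qed.

End LinearAction.

Section Spans.
Variables (F : fieldType) (V : lmodType F) (S : V -> Prop).

Lemma span_in u : S u -> Defs.span S u.
Proof. by move=> Su; have := Defs.span_cons 1 Su (Defs.span_zero S); rewrite scale1r addr0. Qed.

Lemma span_lin a u v : Defs.span S u -> Defs.span S v -> Defs.span S (a *: u + v).
Proof.
move=> Su Sv; elim: Su => [|b w w' Sw _ IHw]; first by rewrite scaler0 add0r.
by rewrite scalerDr scalerA -addrA; apply: Defs.span_cons.
Qed.

Lemma span_sub (T : V -> Prop) : T 0 -> (forall a u v, T u -> T v -> T (a *: u + v)) ->
  (forall u, S u -> T u) -> forall u, Defs.span S u -> T u.
Proof. by move=> T0 Tlin ST u; elim=> // a w w' Sw _ Tw'; apply: Tlin => //; apply: ST. Qed.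

End Spans.

Section Realization.
Variables (F : numClosedFieldType) (n : nat) (k : nat -> nat).
Notation N := n.+1.
Notation A := {mpoly F[N * N]}.
Notation P := {mpoly F[nvars n]}.
Notation lam := (lamk n k).
Implicit Types (f g v w : A) (y : P).

Lemma semistd_diag : semistd (diag_mon n lam).
Proof.
have psumE (i J : nat) : (i <= n)%N -> (J <= N)%N ->
    psum (diag_mon n lam) i J = if (i < J)%N then lam i else 0%N.
  move=> i_n JN; rewrite /psum; have entE' (j : 'I_J) :
      ent (diag_mon n lam) i j = if i == j then lam i else 0%N.
    rewrite /ent diag_monE -val_eqE /= !inordK //.
    by rewrite (leq_trans (ltn_ord j)).
  under eq_bigr do rewrite entE'.
  have [iJ|Ji] := ltnP i J.
    rewrite (bigD1 (Ordinal iJ)) //= eqxx big1 ?addn0 // => j ji.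
    by case: eqP => // e; case/eqP: ji; apply: val_inj; rewrite /= -e.
  by rewrite big1 // => j _; case: eqP => // e; move: (ltn_ord j); rewrite -e ltnNge Ji.
move=> i J i_n Jn; rewrite !psumE ?(ltnW i_n) //; last by rewrite ltnW.
rewrite ltnS; case: ifP => // iJ.
by rewrite /lamk [in X in (_ <= X)%N]big_ltn // leq_addl.
Qed.

Lemma exists_hw : exists v, [/\ isL lam v, v != 0 & killed v].
Proof.
have [g [Lg g0 _ _]] := exists_tableau_vector F semistd_diag.
have {}Lg : isL lam g.
  apply: eq_isL Lg => i; rewrite /psum (bigD1 i) //= entE diag_monE eqxx.
  rewrite big1 ?addn0 // => j ji; rewrite entE diag_monE eq_sym.
  by rewrite (negbTE ji).
apply: (@exists_killed _ _ (isL lam) g) => // j j' f _; exact: isL_E.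
Qed.

(** The invariant for the induction on levels. The condition on later rows is what makes the
    truncated [elem m] agree with the full column operator, which preserves L. *)
Definition in_rows (m : nat) y : Prop := exists f, [/\ isL lam f, y = restr f
  & forall a b, (m < a <= n)%N -> (1 <= b <= a)%N -> dx a b y = 0].

Lemma in_rows_lin m a y y' : in_rows m y -> in_rows m y' -> in_rows m (a *: y + y').
Proof.
move=> [f [Lf -> df]] [f' [Lf' -> df']]; exists (a *: f + f').
split; [exact: isL_lin | by rewrite restr_lin|].
by move=> c d mc dc; rewrite linear_op_dx df // df' // scaler0 addr0.
Qed.

Lemma in_rows0 m : in_rows m 0.
Proof.
by exists 0; rewrite restr0; split=> // [|a b _ _]; [apply: isL0 | rewrite /dx mderiv0].
Qed.

Lemma in_rows_offd m a b y : (1 <= m <= n)%N -> (1 <= a <= m.+1)%N ->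
  (1 <= b <= m.+1)%N -> a <> b -> in_rows m y ->
  in_rows m (offd (sl_action F n k m) a b y).
Proof.
move=> mn am bm ab [f [Lf -> df]]; rewrite (offd_restr Lf) //.
exists (Ecol (inord (N - a)) (inord (N - b)) f); split; first exact: isL_E.
  by rewrite restr_Ecol ?(elem_full (m := m)) //; lia.
by move=> c d mc dc; apply: (dx_elem Lf (m := m)); rewrite ?df //; lia.
Qed.

Lemma in_rows_ddiff m a b y : (1 <= m <= n)%N -> (1 <= a <= m.+1)%N ->
  (1 <= b <= m.+1)%N -> in_rows m y ->
  in_rows m (ddiff (sl_action F n k m) a b y).
Proof.
move=> mn am bm [f [Lf -> df]]; rewrite (ddiff_restr Lf) //.
exists (- 1 *: Ecol (inord (N - b)) (inord (N - b)) f
        + Ecol (inord (N - a)) (inord (N - a)) f); split.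
- by apply: isL_lin; apply: isL_E.
- rewrite restr_lin scaleN1r addrC !restr_Ecol; try by lia.
  by rewrite !(elem_full (m := m)) //; lia.
- move=> c d mc dc; rewrite /dx mderivB.
  have := @dx_elem F n k f Lf m c d; rewrite /dx => de.
  have d0 : (restr f)^`M(xidx n c d) = 0 by apply: df.
  by rewrite (de a a) ?(de b b) ?subrr //; lia.
Qed.

Hypothesis n_gt0 : (0 < n)%N.

Lemma in_rows1 m : in_rows m 1.
Proof.
have [v [Lv v0 kv]] := exists_hw; have [a a0 rv] := restr_killed_const n_gt0 Lv v0 kv.
exists (a^-1 *: v); split; first exact: isLZ.
  by rewrite restrZ rv -mul_mpolyC -mpolyCM mulVf // mpolyC1.
by move=> c d _ _; rewrite /dx -mpolyC1 mderivC.
Qed.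

(** E_(1,2) sends x^i to (i - k_n) x^(i+1), and the factor is nonzero below k_n, so all these powers
    are reached from 1. *)
Lemma in_rows_pow i : (i <= k n)%N -> in_rows 1 (x F n 1 1 ^+ i).
Proof.
have dpow e : x F n 1 1 ^+ 2 * dx 1 1 (x F n 1 1 ^+ e) = e%:R *: x F n 1 1 ^+ e.+1.
  elim: e => [|e IHe].
    by rewrite expr0 /dx -mpolyC1 mderivC mulr0 scale0r.
  have -> : dx 1 1 (x F n 1 1 ^+ e.+1)
      = x F n 1 1 ^+ e + x F n 1 1 * dx 1 1 (x F n 1 1 ^+ e).
    rewrite exprS {1}/dx mderivM; congr (_ + _).
    by have := @dx_x F n 1 1 1 1; rewrite /dx => ->; rewrite ?mul1r.
  rewrite mulrDr mulrCA IHe -scalerAr -exprS -exprD -natr1 scalerDl scale1r addrC.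
  by congr (_ + _ ^+ _); lia.
elim: i => [|i IHi] ik; first exact: in_rows1.
have := @in_rows_offd 1 1 2 _ n_gt0 isT isT _ (IHi (ltnW ik)).
rewrite /= dpow -exprS -scalerBl => R1'.
have {R1'} R1 := R1' ltac:(by []).
have ik0 : i%:R - (k n)%:R != 0 :> F by rewrite subr_eq0 eqr_nat; lia.
rewrite -[_ ^+ _]scale1r -(mulVf ik0) -scalerA -[_ *: _]addr0.
by apply: in_rows_lin => //; apply: in_rows0.
Qed.

Lemma Vmod_in_rows m y : (1 <= m <= n)%N -> Vmod k m y -> in_rows m y.
Proof.
elim: m y => // m IHm y mn; case: m IHm mn => [|m] IHm mn /=.
  apply: span_sub; [exact: in_rows0 | by move=> *; apply: in_rows_lin|].
  by move=> u [i ik ->]; apply: in_rows_pow.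
apply: span_sub; [exact: in_rows0 | by move=> *; apply: in_rows_lin|].
move=> u; elim=> {u} [w|a b p am bm ab _ IHp|a p am _ IHp].
- move=> /IHm [|f [Lf wE df]]; first by lia.
  by exists f; split=> // a b ma; apply: df; lia.
- exact: in_rows_offd.
- by apply: in_rows_ddiff => //; lia.
Qed.

Lemma Vmod1 m : (1 <= m)%N -> Vmod k m (1 : P).
Proof.
case: m => // m _; elim: m => [|m IHm] /=; apply: span_in; last exact: sl_words_nil.
by exists 0%N.
Qed.

Lemma Vmod_lin m a y y' : (1 <= m)%N -> Vmod k m y -> Vmod k m y' -> Vmod k m (a *: y + y').
Proof. by case: m => // -[|m] _; apply: span_lin. Qed.

(** Level 1 is excluded because V^(1) is defined by explicit powers instead of words in the
    operators. *)
Lemma Vmod_offd m a b y : (2 <= m)%N -> (1 <= a <= m.+1)%N ->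
  (1 <= b <= m.+1)%N -> a <> b -> Vmod k m y ->
  Vmod k m (offd (sl_action F n k m) a b y).
Proof.
move=> m2 am bm ab; have lin := (linear_op_sl_action F n k m).1 a b.
have lin0 : offd (sl_action F n k m) a b 0 = 0.
  by have := lin (- 1) 0 0; rewrite scaler0 addr0 scaleN1r addNr.
case: m m2 am bm lin lin0 => // -[|m] // _ am bm lin lin0.
apply: (@span_sub _ _ _ (fun y => Vmod k m.+2 (offd (sl_action F n k m.+2) a b y))).
- by rewrite lin0; apply: Defs.span_zero.
- by move=> c u v Vu Vv; rewrite lin; apply: span_lin.
- by move=> u Wu; apply: span_in; apply: sl_words_offd.
Qed.

Variable gam : seq 'X_{1..N * N}.
Hypothesis gam_uniq : uniq gam.
Hypothesis mem_gam : forall m,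
  reflect (semistd m /\ forall i : 'I_N, psum m i N = lam i) (m \in gam).

(** One inclusion is the invariant [in_rows]. Conversely L is generated by [v], which restricts to a
    constant, and V^(n) contains 1 and is stable under the operators [offd]. *)
Lemma Vmod_restr y : (2 <= n)%N ->
  Vmod k n y <-> exists2 f, isL lam f & y = restr f.
Proof.
move=> n2; split=> [/Vmod_in_rows[|f [Lf -> _]]|[f Lf ->]]; first by lia.
  by exists f.
have [v [Lv v0 kv]] := exists_hw; have [a a0 rv] := restr_killed_const n_gt0 Lv v0 kv.
have [b bP] := exists_tableau_basis F mem_gam.
have gen_f : gl_generated v f.
  by apply: (@isL_is_gl_generated F n lam gam gam_uniq mem_gam b) => // t; have [] := bP t.
have V0 : Vmod k n (0 : P) by case: (n) n2 => // -[|m] // _; apply: Defs.span_zero.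
elim: gen_f => [||j j' g jj' gen_g Vg|c g g' _ Vg _ Vg'].
- by rewrite restr0.
- rewrite rv -alg_mpolyC -[_%:A]addr0.
  by apply: Vmod_lin => //; apply: Vmod1.
- have Lg : isL lam g by apply: isL_gl_generated Lv gen_g.
  have jN := ltn_ord j; have j'N := ltn_ord j'.
  have -> : Ecol j j' g = Ecol (inord (N - (N - j))) (inord (N - (N - j'))) g.
    by rewrite !subKn ?(ltnW jN) ?(ltnW j'N) // !inord_val.
  have ne : (N - j <> N - j')%N by move=> e; case/eqP: jj'; apply: val_inj => /=; lia.
  rewrite restr_Ecol; try by lia.
  rewrite -(offd_restr Lg) //; try by lia.
  by apply: Vmod_offd => //; lia.
- by rewrite restr_lin; apply: Vmod_lin.
Qed.

End Realization.

(** * The grading by the last row of variables *)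

Section Grading.
Variables (F : numClosedFieldType) (n : nat) (k : nat -> nat).
Notation N := n.+1.
Notation A := {mpoly F[N * N]}.
Notation P := {mpoly F[nvars n]}.
Notation lam := (lamk n k).
Implicit Types (f g v w : A) (y : P) (m : 'X_{1..N * N}).

Definition deg_last (mo : 'X_{1..nvars n}) : nat := (\sum_(1 <= s < n.+1) mo (xidx n n s))%N.

Lemma msupp_restr f mo : mo \in msupp (restr f) ->
  exists m, [/\ m \in msupp f, upper m & mo = above m].
Proof.
rewrite /restr /mmap => /msupp_sum_le /flattenP[s /mapP[m]].
rewrite mem_filter /= => mf ->; rewrite mmap1_zval.
case: ifP => [um|_]; last by rewrite mulr0 msupp0.
rewrite mul_mpolyC => /msuppZ_le /msuppZ_le; rewrite msuppX inE => /eqP ->.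
by exists m.
Qed.

(** The variables x_(n,s) are the entries of row 0 to the right of the diagonal; only (0,0) is
    missing from the row sum. *)
Lemma deg_last_above m : (deg_last (above m) + ent m 0 0)%N = psum m 0 N.
Proof.
rewrite /psum -(big_mkord xpredT (ent m 0)) big_ltn // addnC; congr (_ + _)%N.
rewrite [RHS]big_nat_rev; apply: eq_big_nat => s /andP[s1 sN].
have s'N : (N - s < N)%N by lia.
have := @aboveE n m ord0 (inord (N - s)); rewrite /= inordK // subn0 subKn; last by lia.
move=> ->; last by lia.
rewrite /ent add1n subSS; congr (m (zidx _ _)); apply: val_inj; by rewrite /= inordK.
Qed.

Lemma colsum_upper m : upper m -> colsum m ord0 = ent m 0 0.
Proof.
move=> /forallP um; rewrite /colsum (bigD1 ord0) //= big1 ?addn0 => [|i i0].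
  by rewrite /ent; congr (m (zidx _ _)); apply: val_inj; rewrite /= inordK.
have /forallP/(_ ord0) := um i.
by rewrite lt0n -[(i : nat) != 0%N]/(i != ord0) i0 => /eqP.
Qed.

(** In an upper triangular monomial column 0 consists of the entry (0,0) alone, so a constant sum of
    column 0 makes the restriction homogeneous. *)
Lemma deg_last_restr f (w : nat) : isL lam f ->
  (forall m, m \in msupp f -> colsum m ord0 = w) ->
  forall mo, mo \in msupp (restr f) -> (deg_last mo + w)%N = lam 0.
Proof.
move=> Lf cf mo /msupp_restr[m [mf um ->]].
rewrite -(isL_psum ord0 Lf mf) -deg_last_above.
by rewrite -(cf m mf) colsum_upper.
Qed.

Variable gam : seq 'X_{1..N * N}.
Hypothesis gam_uniq : uniq gam.
Hypothesis mem_gam : forall m,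
  reflect (semistd m /\ forall i : 'I_N, psum m i N = lam i) (m \in gam).

Lemma Vgr_dim r : (2 <= n)%N ->
  has_dim (@Vgr F n k r) (count (fun m => ent m 0 0 + r == lam 0)%N gam).
Proof.
move=> n2; have n_gt0 : (0 < n)%N by apply: leq_trans n2.
have [b bP] := exists_tableau_basis F mem_gam.
pose good := [pred t : 'I_(size gam) | ent (nth 0%MM gam t) 0 0 + r == lam 0]%N.
have -> : count (fun m => ent m 0 0 + r == lam 0)%N gam = #|good|.
  rewrite -sum1_card -sum1_count (big_nth 0%MM) big_mkord.
  by apply: eq_bigl => t.
have bL t : isL lam (b t) by have [] := bP t.
have b0 t : b t != 0 by have [] := bP t.
have b_inj : injective (fun t => mlead (b t)).
  move=> t t' /=; have [_ _ -> _] := bP t; have [_ _ -> _] := bP t'.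
  by move/eqP; rewrite nth_uniq // => /eqP/val_inj.
have b_deg t mo : mo \in msupp (restr (b t)) ->
    (deg_last mo + ent (nth 0%MM gam t) 0 0)%N = lam 0.
  apply: deg_last_restr => // m mb; have [_ _ _ ->] := bP t => //.
  apply: colsum_upper; apply/forallP => i; apply/forallP => j; apply/implyP => ji.
  have /mem_gam[std_m _] := mem_nth 0%MM (ltn_ord t).
  by apply/eqP; apply: semistd_tri.
exists (fun t : 'I_#|good| => restr (b (enum_val t))); split=> [t|a a0 t|y [Vy hy]].
- split; first by apply/(Vmod_restr n_gt0 gam_uniq mem_gam) => //; exists (b (enum_val t)).
  move=> mo mob; apply/eqP; rewrite -(eqn_add2r (ent (nth 0%MM gam (enum_val t)) 0 0)).
  by rewrite (b_deg _ _ mob) eq_sym addnC; exact: (enum_valP t).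
- apply: (@mlead_free _ _ _ (fun t => b (enum_val t))) => //.
    by move=> s s' /b_inj /enum_val_inj.
  apply: (@restr_eq0 F n lam).
    by apply: isL_sum => s; apply: isLZ.
  by rewrite restr_sum -[RHS]a0; apply: eq_bigr => s _; rewrite restrZ.
- have [f Lf yE] := (Vmod_restr n_gt0 gam_uniq mem_gam y n2).1 Vy.
  have b_lead t : mlead (b t) = nth 0%MM gam t by have [] := bP t.
  have [e fE] := tableau_span mem_gam bL b0 b_lead Lf.
  exists (fun t => e (enum_val t)).
  rewrite -(big_enum_val (A := good) (fun t => e t *: restr (b t))) /=.
  have yE' : y = \sum_(t | good t) e t *: restr (b t) + \sum_(t | ~~ good t) e t *: restr (b t).
    rewrite yE fE restr_sum (bigID good) /=; congr (_ + _);
      by apply: eq_bigr => t _; rewrite restrZ.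
  (* Monomials of degree r do not occur in the vectors outside [good], and other monomials occur
     neither in [y] nor in the good vectors. *)
  apply/mpolyP => mo; rewrite [in LHS]yE' mcoeffD.
  have [mo_r|mo_r] := eqVneq (deg_last mo) r.
    suff -> : (\sum_(t | ~~ good t) e t *: restr (b t))@_mo = 0 by rewrite addr0.
    rewrite raddf_sum; apply: big1 => t bad_t /=.
    rewrite mcoeffZ memN_msupp_eq0 ?mulr0 //; apply: contra bad_t => /b_deg.
    by rewrite mo_r addnC => /= ->.
  rewrite -mcoeffD -yE' memN_msupp_eq0; last first.
    by apply: contra mo_r => /hy e'; apply/eqP.
  rewrite raddf_sum big1 //= => t good_t.
  rewrite mcoeffZ memN_msupp_eq0 ?mulr0 //; apply: contra mo_r => /b_deg.
  by move: good_t => /= /eqP <- /eqP; rewrite addnC eqn_add2l.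
Qed.

End Grading.

(** * Counting Gelfand-Tsetlin patterns *)

Section BinomialDeterminants.
Variable F : numFieldType.

(** The matrix is a transposed Vandermonde matrix times the triangular matrix of coefficients. *)
Lemma det_horner (m : nat) (p : 'I_m -> {poly F}) (a : 'I_m -> F) :
  (forall j : 'I_m, size (p j) <= j.+1)%N ->
  \det (\matrix_(i < m, j < m) (p j).[a i])
  = (\prod_(j < m) (p j)`_j) * \prod_(i < m) \prod_(j < m | (i < j)%N) (a j - a i).
Proof.
move=> size_p; pose T := \matrix_(t < m, j < m) (p j)`_t.
have -> : \matrix_(i < m, j < m) (p j).[a i] = (Vandermonde m (\row_i a i))^T *m T.
  apply/matrixP => i j; rewrite !mxE.
  rewrite (@horner_coef_wide _ m); last by rewrite (leq_trans (size_p j)).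
  by apply: eq_bigr => t _; rewrite !mxE mulrC.
rewrite det_mulmx det_tr det_Vandermonde mulrC; congr (_ * _).
  rewrite -det_tr det_trig; first by apply: eq_bigr => j _; rewrite !mxE.
  apply/is_trig_mxP => i j ij; rewrite !mxE nth_default //.
  exact: leq_trans (size_p i) _.
by apply: eq_bigr => i _; apply: eq_bigr => j _; rewrite !mxE.
Qed.

Lemma det_rev (m : nat) (M : 'M[F]_m) :
  \det M = \det (\matrix_(i, j) M (rev_ord i) (rev_ord j)).
Proof.
have -> : \matrix_(i, j) M (rev_ord i) (rev_ord j)
    = row_perm (perm (@rev_ord_inj m)) (col_perm (perm (@rev_ord_inj m)) M).
  by apply/matrixP => i j; rewrite !mxE !permE.
rewrite row_permE col_permE !det_mulmx !det_perm mulrCA mulrA odd_permV -mulrA.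
by rewrite -expr2 sqrr_sign mulr1.
Qed.

Lemma fact_prod_sub j : j`! = (\prod_(i < j) (j - i))%N.
Proof.
elim: j => [|j IHj]; first by rewrite big_ord0.
by rewrite big_ord_recl subn0 factS IHj.
Qed.

(** After reversing both indices, column j is a polynomial of degree j with leading coefficient
    1/j!, and j! is the product of the differences j - i. *)
Lemma det_binomial (m : nat) (a : nat -> nat) :
  \det (\matrix_(i < m.+1, j < m.+1) ('C(a i, m - j))%:R : 'M[F]_m.+1)
  = \prod_(i < m.+1) \prod_(j < m.+1 | (i < j)%N)
      (((a i)%:R - (a j)%:R) / (j - i)%N%:R).
Proof.
rewrite det_rev.
pose p (j : 'I_m.+1) : {poly F} := (j`!%:R)^-1 *: \prod_(i < j) ('X - (i%:R : F)%:P).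
have size_p (j : 'I_m.+1) : (size (p j) <= j.+1)%N.
  apply: leq_trans (size_scale_leq _ _) _.
  by rewrite size_prod_XsubC /index_enum -enumT size_enum_ord.
have -> : \matrix_(i, j) (\matrix_(i < m.+1, j < m.+1) ('C(a i, m - j))%:R : 'M[F]_m.+1)
    (rev_ord i) (rev_ord j) = \matrix_(i, j) (p j).[(a (rev_ord i))%:R].
  apply/matrixP => i j; rewrite !mxE /= hornerZ horner_prod.
  under eq_bigr do rewrite hornerXsubC.
  rewrite -natr_ffact -bin_ffact natrM mulrC mulfK; last first.
    by rewrite pnatr_eq0 -lt0n fact_gt0.
  by rewrite subSS subKn // -ltnS.
rewrite det_horner //.
have -> : \prod_(j < m.+1) (p j)`_j = \prod_(j < m.+1) (j`!%:R)^-1.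
  apply: eq_bigr => j _; rewrite coefZ.
  have /monicP := monic_prod_XsubC (index_enum 'I_j) xpredT (fun i : 'I_j => (i%:R : F)).
  rewrite lead_coefE size_prod_XsubC /index_enum -enumT size_enum_ord /= => ->.
  by rewrite mulr1.
under [RHS]eq_bigr do rewrite big_split /=.
rewrite big_split /= [RHS]mulrC; congr (_ * _).
  rewrite [RHS](exchange_big_dep xpredT) //=; apply: eq_bigr => j _.
  rewrite prodfV -natr_prod; congr (_%:R^-1).
  rewrite -(big_ord_widen_cond _ xpredT (fun i => j - i)%N); last by rewrite ltnW.
  exact: fact_prod_sub.
rewrite (reindex_inj rev_ord_inj); under eq_bigr do rewrite (reindex_inj rev_ord_inj).
rewrite (exchange_big_dep xpredT) //=; apply: eq_bigr => j _.
have lt_m := @ltn_ord m.+1; apply: eq_big => [i|i _] /=.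
  by have := lt_m i; have := lt_m j; lia.
by congr ((a _)%:R - (a _)%:R); have := lt_m i; have := lt_m j; lia.
Qed.

End BinomialDeterminants.

Section InterlacingSums.
Variable R : comNzRingType.

Fixpoint interl (al : seq nat) : seq (seq nat) :=
  match al with
  | u :: ((v :: _) as al') => [seq b :: mu | b <- iota v (u.+1 - v), mu <- interl al']
  | _ => [:: [::]]
  end.

Lemma mem_interl al mu : reflect
  (size mu = (size al).-1 /\
   forall i, (i < size mu)%N -> (nth 0 al i.+1 <= nth 0 mu i <= nth 0 al i)%N)
  (mu \in interl al).
Proof.
elim: al mu => [|u [|v al] IHal] mu.
- by rewrite inE; apply: (iffP eqP) => [->|[/size0nil]].
- by rewrite inE; apply: (iffP eqP) => [->|[/size0nil]].
rewrite [interl _]/=; apply: (iffP allpairsPdep) => [[b [mu' [bI mu'I ->]]]|[]].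
  have [smu' mu'P] := IHal _ mu'I; split=> /=; first by rewrite smu'.
  case=> [|i] //= i_mu; last exact: mu'P.
  by move: bI; rewrite mem_iota; lia.
case: mu => [|b mu] //= [smu] muP; exists b, mu; split=> //.
  by rewrite mem_iota; have := muP 0%N isT; rewrite /=; lia.
by apply/IHal; split=> // i imu; have := muP i.+1; rewrite /= ltnS => /(_ imu).
Qed.

Lemma interl_uniq al : uniq (interl al).
Proof.
elim: al => [|u [|v al] IHal] //; rewrite [interl _]/=.
apply: allpairs_uniq => //; first exact: iota_uniq.
by move=> [b mu] [b' mu'] _ _ /= [-> ->].
Qed.

(** The entries of an interlacing row range independently over intervals, so the sum distributes
    over the product. *)
Lemma interl_prod al (psi : nat -> nat -> R) :
  \sum_(mu <- interl al) \prod_(i < (size al).-1) psi i (nth 0%N mu i)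
  = \prod_(i < (size al).-1) \sum_(nth 0 al i.+1 <= b < (nth 0 al i).+1) psi i b.
Proof.
elim: al psi => [|u [|v al] IHal] psi; try by rewrite big_seq1 !big_ord0.
rewrite [interl _]/= big_allpairs_dep [RHS]big_ord_recl /= -(IHal (fun i => psi i.+1)).
rewrite mulr_suml; apply: eq_bigr => b _; rewrite mulr_sumr; apply: eq_bigr => mu _.
by rewrite big_ord_recl.
Qed.

(* Replacing each row but the last by its difference with the next one. *)
Lemma det_row_diff (m : nat) (Phi : nat -> nat -> R) :
  \det (\matrix_(i < m, j < m) (Phi i j - Phi i.+1 j))
  = \det (\matrix_(i < m.+1, j < m.+1) (if j == m :> nat then 1 else Phi i j)).
Proof.
pose M := \matrix_(i < m.+1, j < m.+1) (if j == m :> nat then 1 else Phi i j).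
pose T := \matrix_(i < m.+1, j < m.+1)
  ((i == j)%:R - (j == i.+1 :> nat)%:R : R).
have detT : \det T = 1.
  rewrite -det_tr det_trig.
    by apply: big1 => i _; rewrite !mxE eqxx ltn_eqF // subr0.
  apply/is_trig_mxP => i j ij; rewrite !mxE [j == i]eq_sym.
  by rewrite -!val_eqE /= !ltn_eqF ?subr0 // ltnW.
(* The column of ones becomes zero except for its bottom entry, and the remaining minor consists of
   the differences. *)
rewrite -[RHS]mul1r -{1}detT -det_mulmx (expand_det_col _ ord_max).
have TM i j : (T *m M) i j = M i j - (if (i < m)%N then M (inord i.+1) j else 0).
  rewrite [LHS]mxE; under eq_bigr do rewrite mxE mulrBl.
  rewrite sumrB; congr (_ - _).
    rewrite (bigD1 i) //= eqxx mul1r big1 ?addr0 ?mxE // => t ti.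
    by rewrite eq_sym (negbTE ti) mul0r.
  case: ifP => im.
    rewrite (bigD1 (inord i.+1)) //= inordK // eqxx mul1r big1 ?addr0 // => t ti.
    case: eqP => [e|]; last by rewrite mul0r.
    by case/eqP: ti; apply: val_inj; rewrite /= inordK.
  rewrite big1 // => t _; case: eqP => [e|]; last by rewrite mul0r.
  by have := ltn_ord t; rewrite e ltnS im.
rewrite big_ord_recr big1 ?add0r => [|i _]; last first.
  by rewrite TM /= ltn_ord !mxE /= eqxx subrr mul0r.
rewrite TM ltnn subr0 mxE /= eqxx mul1r /cofactor -signr_odd /= addnn odd_double mul1r ?add0r.
congr (\det _); apply/matrixP => i j; rewrite [LHS]mxE.
transitivity ((T *m M) (lift ord_max i) (lift ord_max j)); last by rewrite !mxE.
rewrite TM lift_max ltn_ord /M !mxE inordK ?ltnS // !lift_max.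
by rewrite !ltn_eqF.
Qed.

End InterlacingSums.

Fixpoint pats (m : nat) (al : seq nat) : seq (seq (seq nat)) :=
  if m is m'.+1 then [seq mu :: p | mu <- interl al, p <- pats m' mu] else [:: [::]].

Definition corner (al : seq nat) (p : seq (seq nat)) : nat := head 0%N (last al p).

Definition cnt (m : nat) (al : seq nat) (w : nat) : nat :=
  count (fun p => corner al p == w) (pats m al).

Lemma cntS m al w : cnt m.+1 al w = (\sum_(mu <- interl al) cnt m mu w)%N.
Proof.
rewrite /cnt /= -sum1_count big_mkcond big_allpairs_dep; apply: eq_bigr => mu _.
by rewrite -sum1_count [RHS]big_mkcond.
Qed.

Lemma mem_pats m al p : reflect
  (size p = m /\ forall t, (t < m)%N -> nth [::] p t \in interl (nth [::] (al :: p) t))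
  (p \in pats m al).
Proof.
elim: m al p => [|m IHm] al p /=.
  by rewrite inE; apply: (iffP eqP) => [->|[/size0nil]].
apply: (iffP allpairsPdep) => [[mu [p' [muI /IHm[sp' p'P] ->]]]|[]].
  by split=> [|[|t]] /=; rewrite ?sp' //; apply: p'P.
case: p => [|mu p] //= [sp] pP; exists mu, p; split=> //; first exact: (pP 0%N).
by apply/IHm; split=> // t tm; apply: (pP t.+1).
Qed.

Lemma pats_uniq m al : uniq (pats m al).
Proof.
elim: m al => [|m IHm] al //=; apply: allpairs_uniq_dep => //.
- exact: interl_uniq.
- by move=> [mu p] [mu' p'] _ _ /= [-> ->].
Qed.

Section CountingFormula.
Variable R : numFieldType.

(** The m-fold discrete antiderivative, in [b], of the indicator of [w]. *)
Definition corner_col (m w b : nat) : nat :=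
  if m is m'.+1 then if (w < b)%N then 'C(b - w.+1, m') else 0%N else (b == w).

Lemma corner_colS m w b : corner_col m.+1 w b.+1 = (corner_col m.+1 w b + corner_col m w b)%N.
Proof.
rewrite /corner_col ltnS subSS; have [wb|bw|<-] := ltngtP w b.
- by rewrite -(subnSK wb); case: m => [|m]; rewrite ?bin0 ?addn0 // binS.
- by case: m => [|m] //; rewrite gtn_eqF.
- by rewrite subnn; case: m => [|m] //; rewrite eqxx.
Qed.

(** The usual binomial columns, with column 0 replaced by the one that records the corner. Taking
    differences in [b] lowers [m] in every column alike. *)
Definition schur_col (m w j b : nat) : R :=
  (if j == 0%N then corner_col m w b else 'C(b, m - j))%:R.

Lemma schur_colS m w j b : (j <= m)%N ->
  schur_col m.+1 w j b.+1 - schur_col m.+1 w j b = schur_col m w j b.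
Proof.
rewrite /schur_col; case: eqP => [_ _|_ jm].
  by rewrite corner_colS natrD addrAC subrr add0r.
by rewrite subSn // binS natrD addrAC subrr add0r.
Qed.

(** Summing over the next row of the pattern, the sum in each matrix entry telescopes to a
    difference of consecutive rows; [det_row_diff] turns these into a determinant one size larger,
    whose new column of ones is the binomial with lower index 0. *)
Lemma cnt_det m al w : size al = m.+1 ->
  (forall i, (nth 0 al i.+1 <= nth 0 al i)%N) ->
  (cnt m al w)%:R
  = \det (\matrix_(i < m.+1, j < m.+1) schur_col m w j (nth 0%N al i + (m - i))).
Proof.
elim: m al => [|m IHm] al sal al_dec.
  rewrite det_mx11 mxE /schur_col /= addn0 /cnt /= addn0 /corner /=.
  by case: al sal al_dec => [|u [|]].
rewrite cntS natr_sum.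
rewrite (eq_big_seq (fun mu => \sum_(s : {perm 'I_m.+1}) (-1) ^+ s *
    \prod_(i < m.+1) schur_col m w (s (inord i)) (nth 0%N mu i + (m - i)))); last first.
  move=> mu /mem_interl[smu muP]; rewrite sal /= in smu.
  rewrite IHm //; first last.
    move=> i; have [imu|mui] := ltnP i (size mu); last by rewrite nth_default // ltnW.
    have /andP[le1 _] := muP i imu; have [imu'|mui'] := ltnP i.+1 (size mu).
      by have /andP[_ le2] := muP _ imu'; apply: leq_trans le2 le1.
    by rewrite nth_default.
  apply: eq_bigr => s _; congr (_ * _); apply: eq_bigr => i _.
  by rewrite mxE inord_val.
rewrite exchange_big /=.
pose Phi (i j : nat) : R := schur_col m.+1 w j (nth 0%N al i + (m.+1 - i)).
transitivity (\det (\matrix_(i < m.+1, j < m.+1) (Phi i j - Phi i.+1 j))).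
  apply: eq_bigr => s _; rewrite -mulr_sumr; congr (_ * _).
  have := @interl_prod R al (fun i b => schur_col m w (s (inord i)) (b + (m - i))).
  rewrite sal /= => ->; apply: eq_bigr => i _; rewrite mxE inord_val.
  pose G b := schur_col m.+1 w (s i) (b + (m - i)).
  rewrite (eq_bigr (fun b => G b.+1 - G b)) => [|b _]; last first.
    by rewrite /G addSn schur_colS // -ltnS.
  rewrite telescope_sumr; last by apply: leq_trans (al_dec i) _.
  have im : (i <= m)%N by rewrite -ltnS.
  by rewrite /G /Phi addSnnS -subSn // subSS.
rewrite det_row_diff; congr (\det _); apply/matrixP => i j; rewrite !mxE /Phi.
by case: eqP => // ->; rewrite /schur_col subnn bin0.
Qed.

End CountingFormula.

(** * Dimensions as determinants of binomial coefficients *)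

Section DimensionFormulas.
Variable k : nat -> nat.

Lemma dimsl_det m (l a : nat -> nat) :
  (forall i, (i < m)%N -> a i = (a i.+1 + (l i.+1).+1)%N) ->
  dimsl m l = \det (\matrix_(i < m.+1, j < m.+1) ('C(a i, m - j))%:R).
Proof.
move=> aS; have a_diff i j : (i <= j <= m)%N ->
    a i = (a j + (\sum_(i.+1 <= r < j.+1) l r + (j - i)))%N.
  elim: j => [|j IHj] /andP[ij jm].
    by move: ij; rewrite leqn0 => /eqP ->; rewrite big_geq // subnn !addn0.
  move: ij; rewrite leq_eqVlt => /orP[/eqP ->|ij].
    by rewrite big_geq // subnn !addn0.
  rewrite big_nat_recr //= IHj ?(aS j) //; last by rewrite -ltnS ij ltnW.
  by rewrite subSn //; lia.
rewrite det_binomial /dimsl big_add1 /= big_mkord; apply: eq_bigr => i _.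
rewrite big_add1 /= big_geq_mkord; apply: eq_big => // j ij.
have jm : (j <= m)%N by rewrite -ltnS.
rewrite (a_diff i j) ?(ltnW ij) // subSS; congr (_ / _).
by rewrite [in RHS]natrD addrAC subrr add0r.
Qed.

(* lambda_s + (n - s); the numerators in [dimsl] are differences of these. *)
Definition shifted (n s : nat) : nat := (\sum_(s <= r < n) (k r.+1).+1)%N.

Lemma shiftedS n s : (s < n)%N -> shifted n s = (shifted n s.+1 + (k s.+1).+1)%N.
Proof. by move=> sn; rewrite /shifted big_ltn // addnC. Qed.

Lemma dimsl_top n :
  dimsl n k = \det (\matrix_(i < n.+1, j < n.+1) ('C(shifted n i, n - j))%:R).
Proof. by apply: dimsl_det => i i_n; rewrite shiftedS. Qed.

(** Omitting the number with index [s] merges the gaps k_s + 1 and k_(s+1) + 1 into one, that is,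
    into the coefficient k_s + k_(s+1) + 1 of lambda_s; later coefficients shift by one place. *)
Lemma dimsl_wt n s : (s <= n.+1)%N -> dimsl n (wt k s)
  = \det (\matrix_(i < n.+1, j < n.+1) ('C(shifted n.+1 (bump s i), n - j))%:R).
Proof.
move=> sn; apply: (@dimsl_det n _ (fun i => shifted n.+1 (bump s i))) => i i_n.
rewrite /bump /wt; have [is1|is1|is1] := ltngtP i.+1 s.
- have -> : (s <= i)%N = false by lia.
  by rewrite !add0n shiftedS; [rewrite !addn0|lia].
- have -> : (s <= i)%N = true by lia.
  by rewrite !add1n shiftedS; [rewrite !add0n | lia].
- have -> : (s <= i)%N = false by lia.
  rewrite add0n add1n (@shiftedS _ i); last by lia.
  by rewrite (@shiftedS _ i.+1); lia.
Qed.

(** Expansion along column 0, whose minors are evaluated by [dimsl_wt]. The hypothesis removes the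
    term of the last row, which the sum does not include. *)
Lemma laplace_dimsl n (h : nat -> rat) : h n.+1 = 0 ->
  \det (\matrix_(i < n.+2, j < n.+2)
     (if j == 0%N :> nat then h i else ('C(shifted n.+1 i, n.+1 - j))%:R))
  = \sum_(0 <= s < n.+1) (-1) ^+ s * h s * dimsl n (wt k s).
Proof.
move=> h0; rewrite (expand_det_col _ ord0) big_ord_recr /= mxE /= h0 mul0r addr0.
rewrite big_mkord; apply: eq_bigr => s _; rewrite mxE /= dimsl_wt ?(ltnW (ltn_ord s)) //.
rewrite /cofactor /= addn0 mulrCA mulrA; congr (_ * \det _).
by apply/matrixP => i j; rewrite !mxE lift0 /= subSS.
Qed.

End DimensionFormulas.

(** * Semistandard tableaux as Gelfand-Tsetlin patterns *)

Section Patterns.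
Variables (n : nat) (k : nat -> nat).
Notation N := n.+1.
Notation lam := (lamk n k).
Implicit Types (m : 'X_{1..N * N}) (p : seq (seq nat)).

Definition top : seq nat := mkseq lam N.

(* Gelfand-Tsetlin patterns: the shape of the letters 0, ..., J is the entry
   n - J of [top :: p]. *)
Definition pat_mon p : 'X_{1..N * N} :=
  [multinom (nth 0%N (nth [::] (top :: p) (n - zcol l)) (zrow l)
    - nth 0%N (nth [::] (top :: p) (n - zcol l).+1) (zrow l))%N | l < N * N].

Definition mon_pat m : seq (seq nat) :=
  mkseq (fun t => mkseq (fun i => psum m i (n - t)) (n - t)) n.

Section PatternProps.
Variable p : seq (seq nat).
Hypothesis pP : p \in pats n top.

Let q := top :: p.

Lemma pat_size : size p = n. Proof. by have [] := mem_pats _ _ _ pP. Qed.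

Lemma pat_row_size t : (t <= n)%N -> size (nth [::] q t) = (N - t)%N.
Proof.
have [_ pI] := mem_pats _ _ _ pP; elim: t => [|t IHt] tn; first by rewrite size_mkseq.
have [/= -> _] := mem_interl _ _ (pI t tn).
by rewrite IHt ?(ltnW tn) // subSS subSn // ltnW.
Qed.

(** The default value 0 beyond the ends of the rows, and the empty row after the last one, keep the
    inequalities valid for every i. *)
Lemma pat_interl t i : (t <= n)%N ->
  (nth 0 (nth [::] q t) i.+1 <= nth 0 (nth [::] q t.+1) i <= nth 0 (nth [::] q t) i)%N.
Proof.
move=> tn; have [_ pI] := mem_pats _ _ _ pP.
have sq := pat_row_size tn.
have [lt_t|] := ltnP t n; last first.
  move=> nt; rewrite [nth [::] q t.+1]nth_default; last by rewrite /= pat_size.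
  by rewrite !nth_nil leq0n andbT nth_default // sq; lia.
have [s_mu mu_le] := mem_interl _ _ (pI t lt_t).
have [i_lt|i_ge] := ltnP i (size (nth [::] p t)); first exact: mu_le.
rewrite [nth 0%N (nth [::] q t.+1) i]nth_default // leq0n andbT nth_default //.
by move: i_ge; rewrite s_mu /= -/q sq; lia.
Qed.

(** The differences in [pat_mon] telescope, [pat_interl] ensuring that no subtraction is
    truncated. *)
Lemma psum_pat_mon i J : (i <= n)%N -> (J <= N)%N ->
  psum (pat_mon p) i J = nth 0%N (nth [::] q (N - J)) i.
Proof.
move=> i_n; elim: J => [|J IHJ] JN.
  rewrite /psum big_ord0 subn0 [nth [::] q N]nth_default ?nth_nil //.
  by rewrite /= pat_size.
rewrite /psum big_ord_recr /= -/(psum _ i J) IHJ; last exact: ltnW.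
rewrite /ent mnmE zrowK zcolK !inordK // subSS -subSn //.
have := @pat_interl (n - J) i (leq_subr _ _); rewrite -subSn //.
by move=> /andP[_ le]; rewrite subnKC.
Qed.

Lemma pat_mon_semistd : semistd (pat_mon p).
Proof.
move=> i J i_n Jn; rewrite !psum_pat_mon ?(ltnW i_n) //; last exact: ltnW.
have := @pat_interl (n - J) i (leq_subr _ _).
by rewrite subSS -subSn // => /andP[].
Qed.

Lemma pat_monK : mon_pat (pat_mon p) = p.
Proof.
apply: (@eq_from_nth _ [::]); rewrite size_mkseq ?pat_size // => t tn.
rewrite nth_mkseq //; have st := @pat_row_size t.+1 tn; rewrite /= subSS in st.
apply: (@eq_from_nth _ 0%N); rewrite size_mkseq // => i it.
rewrite nth_mkseq // psum_pat_mon; try by lia.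
by have -> : (N - (n - t))%N = t.+1 by lia.
Qed.

End PatternProps.

Lemma psum_inj m m' :
  (forall i J, (i <= n)%N -> (J <= N)%N -> psum m i J = psum m' i J) -> m = m'.
Proof.
move=> e; apply/mnmP => l; rewrite -(zidxK l) -!entE.
move: (zrow l) (zcol l) => i j; have i_n : (i <= n)%N by rewrite -ltnS.
have := e i j.+1 i_n (ltn_ord j); have := e i j i_n (ltnW (ltn_ord j)).
by rewrite /psum !big_ord_recr /= => -> /addnI.
Qed.

Lemma psum_low m i J : semistd m -> (i <= n)%N -> (J <= i)%N -> psum m i J = 0%N.
Proof.
move=> std_m i_n Ji; rewrite /psum big1 // => j _.
have jn : (j <= n)%N by have := ltn_ord j; lia.
by rewrite /ent (semistd_tri std_m) // !inordK //; have := ltn_ord j; lia.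
Qed.

Lemma mon_patP m : semistd m -> (forall i : 'I_N, psum m i N = lam i) ->
  mon_pat m \in pats n top /\ pat_mon (mon_pat m) = m.
Proof.
move=> std_m row_m.
have topE : top = mkseq (fun i => psum m i N) N.
  apply: (@eq_from_nth _ 0%N); rewrite !size_mkseq // => i iN.
  by rewrite !nth_mkseq // (row_m (Ordinal iN)).
have qE t : (t <= n)%N ->
    nth [::] (top :: mon_pat m) t = mkseq (fun i => psum m i (N - t)) (N - t).
  by case: t => [|t] tn; rewrite ?topE ?subn0 //= nth_mkseq.
have pP : mon_pat m \in pats n top.
  apply/mem_pats; split=> [|t tn]; first by rewrite size_mkseq.
  rewrite -[nth [::] (mon_pat m) t]/(nth [::] (top :: mon_pat m) t.+1).
  rewrite !qE //; last exact: ltnW.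
  apply/mem_interl; rewrite !size_mkseq; split=> [|i it]; first by lia.
  rewrite !nth_mkseq; try by lia.
  have -> : (N - t)%N = (N - t.+1).+1 by lia.
  rewrite std_m; try by lia.
  by rewrite /psum big_ord_recr /= leq_addr.
split=> //; apply: psum_inj => i J i_n JN; rewrite psum_pat_mon //.
have [J0|J_gt0] := posnP J.
  rewrite J0 subn0 [nth [::] _ N]nth_default ?nth_nil; last by rewrite /= size_mkseq.
  by rewrite /psum big_ord0.
rewrite qE; last by lia.
have -> : (N - (N - J))%N = J by lia.
have [iJ|Ji] := ltnP i J; first by rewrite nth_mkseq.
by rewrite nth_default ?size_mkseq // psum_low.
Qed.

Definition pattern_mons : seq 'X_{1..N * N} := [seq pat_mon p | p <- pats n top].

Lemma pattern_mons_uniq : uniq pattern_mons.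
Proof.
rewrite map_inj_in_uniq ?pats_uniq // => p p' pP p'P e.
by rewrite -(pat_monK pP) e pat_monK.
Qed.

Lemma mem_pattern_mons m :
  reflect (semistd m /\ forall i : 'I_N, psum m i N = lam i) (m \in pattern_mons).
Proof.
apply: (iffP mapP) => [[p pP ->]|[std_m row_m]].
  split=> [|i]; first exact: pat_mon_semistd.
  by rewrite psum_pat_mon // -1?ltnS // subnn nth_mkseq.
by have [mP mE] := mon_patP std_m row_m; exists (mon_pat m).
Qed.

(** The exponent at (0,0) is the only entry of the last row of the pattern. *)
Lemma count_pattern_mons r : (r <= lam 0)%N ->
  count (fun m => ent m 0 0 + r == lam 0)%N pattern_mons = cnt n top (lam 0 - r).
Proof.
move=> rl; rewrite count_map /cnt; apply: eq_in_count => p pP /=.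
have -> : ent (pat_mon p) 0 0 = psum (pat_mon p) 0 1 by rewrite /psum big_ord1.
rewrite psum_pat_mon // subSS subn0 /corner.
have -> : nth [::] (top :: p) n = last top p by rewrite (last_nth [::]) pat_size.
rewrite nth0; move: (head _ _) => h.
by apply/eqP/eqP; lia.
Qed.

End Patterns.

Lemma top_dec n k i : (nth 0 (top n k) i.+1 <= nth 0 (top n k) i)%N.
Proof.
have [i_n|n_i] := ltnP i.+1 n.+1; last by rewrite nth_default ?size_mkseq.
rewrite !nth_mkseq //; last exact: ltnW.
by rewrite /lamk [in X in (_ <= X)%N]big_ltn // leq_addl.
Qed.

Lemma top_shifted n k i : (i <= n)%N -> (nth 0 (top n k) i + (n - i))%N = shifted k n i.
Proof.
move=> i_n; rewrite nth_mkseq // /lamk /shifted.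
under [RHS]eq_bigr do rewrite -addn1.
by rewrite big_split /= sum_nat_const_nat muln1.
Qed.

Theorem corollary3p4 (R : realType) (n : nat) (k : nat -> nat) (hn : (2 <= n)%N) :
  (forall r : nat, (r <= \sum_(1 <= i < n.+1) k i)%N ->
     exists2 d : nat,
       has_dim (@Vgr R[i] n k r) d
       & d%:R = \sum_(0 <= s < n)
           (-1) ^+ s
           * (binz ((n + r - 1)%N%:Z - (\sum_(1 <= j < s.+1) (k j + 1))%N%:Z)
                (n - 1))%:R
           * dimsl (n - 1) (wt k s) :> rat)
  /\ \sum_(0 <= s < n)
        (-1) ^+ s
        * (binz (\sum_(s.+1 <= j < n.+1) (k j + 1))%N%:Z n)%:R
        * dimsl (n - 1) (wt k s) = dimsl n k :> rat.
Proof.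
case: n hn => [|[|n']] // hn; set n := n'.+2 in hn *.
have n1 : (n - 1)%N = n'.+1 by rewrite subn1.
have shiftedE s : (\sum_(s.+1 <= j < n.+1) (k j + 1))%N = shifted k n s.
  by rewrite big_add1 /=; apply: eq_bigr => j _; rewrite addn1.
have lam0 : lamk n k 0 = (\sum_(1 <= i < n.+1) k i)%N by rewrite big_add1.
have shifted_n : shifted k n n = 0%N by rewrite /shifted big_geq.
have binz_nat (p q : nat) : binz p%:Z q = 'C(p, q).
  by rewrite /binz lez_nat; case: leqP => // pq; rewrite bin_small.
split=> [r rl|]; last first.
  rewrite n1 dimsl_top -[n]/(n'.+2) in shifted_n *.
  (* With this [h] column 0 has the same binomial form as the other columns, so the determinant is
     the one of [dimsl_top]; [h n] vanishes since [shifted k n n] is 0. *)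
  rewrite -(@laplace_dimsl k n'.+1 (fun s => (binz (\sum_(s.+1 <= j < n.+1) (k j + 1))%N%:Z n)%:R)).
    congr (\det _); apply/matrixP => i j; rewrite !mxE.
    by case: eqP => // ->; rewrite binz_nat shiftedE subn0.
  by rewrite shiftedE shifted_n.
exists (cnt n (top n k) (lamk n k 0 - r)).
  rewrite -count_pattern_mons; last by rewrite lam0.
  apply: Vgr_dim => //; [exact: pattern_mons_uniq | exact: mem_pattern_mons].
rewrite (@cnt_det rat n (top n k) _ (size_mkseq _ _) (@top_dec n k)) n1.
pose h s : rat := (binz ((n + r - 1)%N%:Z - (\sum_(1 <= j < s.+1) (k j + 1))%N%:Z) n'.+1)%:R.
have sumE s : (s <= n)%N ->
    (\sum_(1 <= j < s.+1) (k j + 1) + shifted k n s)%N = (lamk n k 0 + n)%N.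
  move=> sn; have := @top_shifted n k 0 (leq0n n); rewrite nth_mkseq // subn0 => ->.
  rewrite big_add1 /= /shifted [in RHS](big_cat_nat (n := s)) //=; congr (_ + _)%N.
  by apply: eq_bigr => j _; rewrite addn1.
(* Write b for the partial sum, B for [shifted k n s] and w for |lambda| - r. By [sumE] the upper
   index B - w - 1 equals n + r - 1 - b, and w < B means b <= n + r - 1; otherwise both sides are
   0. *)
have hE s : (s <= n)%N -> h s = (corner_col n (lamk n k 0 - r) (shifted k n s))%:R.
  move=> /sumE; rewrite /h -[corner_col n]/(corner_col n'.+2) /corner_col.
  move: (\sum_(1 <= j < s.+1) _)%N (shifted k n s) => b B e; rewrite -lam0 in rl.
  have [bn|nb] := leqP b (n + r - 1).
    rewrite subzn // binz_nat; have -> : (lamk n k 0 - r < B)%N by lia.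
    by congr ('C(_, _)%:R); lia.
  have -> : (lamk n k 0 - r < B)%N = false by lia.
  by rewrite /binz; case: ifP => //; lia.
rewrite -(@laplace_dimsl k n'.+1 h); last by rewrite hE // shifted_n.
congr (\det _); apply/matrixP => i j; rewrite !mxE /schur_col.
have i_n : (i <= n)%N by rewrite -ltnS.
rewrite top_shifted //; case: eqP => // _.
by rewrite hE.
Qed.
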